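(* Let $K$ be an algebraically closed field with characteristic exponent $p$, and let $m,n,r$ be natural numbers with $m,n \geq r$. Let $x=(x_{ij})$ be the $m\times n$ matrix of variables, regarded as coordinates on $K^{m\times n}$. Then there exists no nonzero polynomial $f\in K[x_{ij} \mid i\in[m],j\in[n]]$ with fewer than $(r+1)!$ terms that vanishes on all matrices of rank $r$ in $K^{m\times n}$. Moreover, if $r\geq 2$, then every polynomial with exactly $(r+1)!$ terms that vanishes on all rank-$r$ matrices in $K^{m\times n}$ is of the form $c\,u\cdot D^{p^e}$, where $c\in K^*$, $u$ is a monomial, $D$ is some $(r+1)\times(r+1)$-minor of $x$, and $e$ is a nonnegative integer.
   Context: The characteristic exponent $p$ of $K$ is $1$ if $\operatorname{char}K=0$ and $\operatorname{char}K$ otherwise. The number of terms of a polynomial is the number of monomials appearing in it with nonzero coefficient (with respect to the monomial basis). A ''term'' means a nonzero scalar times a monomial. *)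

(* Defs.v *)
From HB Require Import structures.
From mathcomp Require Import all_boot all_order all_algebra.
From mathcomp Require Import mpoly.
Set Implicit Arguments. Unset Strict Implicit. Unset Printing Implicit Defensive.
Import Order.TTheory GRing.Theory Num.Theory.
Local Open Scope ring_scope.

Definition char_exponent (K : fieldType) (p : nat) : Prop :=
  (p = 1%N /\ [pchar K] =i pred0) \/ (p \in [pchar K]).

Definition xvar (K : fieldType) (m n : nat) (i : 'I_m) (j : 'I_n) : {mpoly K[m * n]} :=
  'X_(mxvec_index i j).

Definition mxpt (K : fieldType) (m n : nat) (A : 'M[K]_(m, n)) : 'I_(m * n) -> K :=
  fun k => mxvec A 0 k.

Definition nterms (K : fieldType) (N : nat) (f : {mpoly K[N]}) : nat := size (msupp f).

Definition vanishes_on_rank (K : fieldType) (m n r : nat) (f : {mpoly K[m * n]}) : Prop :=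
  forall A : 'M[K]_(m, n), \rank A = r -> f.@[mxpt A] = 0.

(* The (k x k)-minor of x given by row selection rs and column selection cs
   (injective selections; the ordering only affects the sign). *)
Definition minor (K : fieldType) (m n k : nat) (rs : 'I_k -> 'I_m) (cs : 'I_k -> 'I_n)
  : {mpoly K[m * n]} :=
  \det (\matrix_(a < k, b < k) xvar K (rs a) (cs b)).

(* Main.v *)
(* Let f vanish on the matrices of rank at most r and sort its terms by the
   exponent vector e of the i-th row, f = \sum_e f_e y^e. The i-th row of a matrix
   of rank < r is unconstrained, so each f_e vanishes on rank < r and, inductively,
   has at least r! terms. If some f_e does not vanish on rank r, then the monomials
   y^e are linearly dependent on an r-dimensional row space. On the space
   { (q(t_1), ..., q(t_n)) | deg q < r } with distinct t_j this is impossible for r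
   or fewer monomials: restrict to q(t_j) = 0 for a coordinate j that separates
   two of them. Hence there are at least r + 1 vectors e, and (r + 1) * r! terms.
   In the extremal case, letting two of the t_j coincide shows that (up to a common
   monomial) the y^e are pure powers y_j^d with j in a set J of size r + 1.
   Identifying two columns l, l' in J leaves at most r row monomials and fewer than
   (r + 1)! terms, so f becomes 0; hence f is alternating under the permutations
   of J, which forces f = c * u * \det (x_ij ^ d_i). Evaluating at matrices
   of rank r shows that all d_i are equal to one d with (x + y)^d = x^d + y^d. *)
Require Import Defs.
From HB Require Import structures.
From mathcomp Require Import all_boot all_order all_algebra.
From mathcomp Require Import fingroup perm.
From mathcomp Require Import mpoly.
From Stdlib Require Import Classical.
Set Implicit Arguments. Unset Strict Implicit. Unset Printing Implicit Defensive.
Import Order.TTheory GRing.Theory Num.Theory.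
Local Open Scope ring_scope.

(** * Polynomial functions of one parameter *)

Section PolynomialFunctions.
Variable K : closedFieldType.

(** If [p] were nonzero, [p * 'X + 1] would be nonconstant and have a root, at which [p] cannot
    vanish. *)
Lemma poly_fun_eq0 (p : {poly K}) : (forall t, p.[t] = 0) -> p = 0.
Proof.
move=> p0; apply/eqP; apply/negPn/negP=> pn0.
have : size (p * 'X + 1%:P) != 1.
  by rewrite size_MXaddC (negPf pn0) /= eqSS size_poly_eq0.
by case/closed_rootP=> t /rootP; rewrite !hornerE p0 mul0r add0r => /eqP; rewrite oner_eq0.
Qed.

(** An algebraically closed field is infinite: if a list [s] contained every element, the monic
    product of the ['X - z] over [s] would vanish everywhere. *)
Lemma ex_inj_ord n : exists t : 'I_n -> K, injective t.
Proof.
have [s s_uniq sz_s] : exists2 s : seq K, uniq s & size s = n.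
  elim: n => [|n [s us <-]]; first by exists [::].
  case: (classic (exists t, t \notin s)) => [[t ts]|H].
    by exists (t :: s); rewrite //= ts.
  have /eqP : \prod_(z <- s) ('X - z%:P) = 0.
    apply: poly_fun_eq0 => t; apply/rootP; rewrite root_prod_XsubC.
    by apply/negPn/negP=> ts; apply: H; exists t.
  by rewrite (negPf (monic_neq0 (monic_prod_XsubC _ _ _))).
exists (fun i => s`_i) => i j /eqP; rewrite nth_uniq ?sz_s //.
by move/eqP/val_inj.
Qed.

Definition polyfun (phi : K -> K) := exists p : {poly K}, forall t, phi t = p.[t].

Lemma polyfunC a : polyfun (fun=> a).
Proof. by exists a%:P => t; rewrite hornerC. Qed.

Lemma polyfunX : polyfun id.
Proof. by exists 'X => t; rewrite hornerX. Qed.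

Lemma polyfunD f g : polyfun f -> polyfun g -> polyfun (fun t => f t + g t).
Proof. by move=> [p Hp] [q Hq]; exists (p + q) => t; rewrite hornerD Hp Hq. Qed.

Lemma polyfunM f g : polyfun f -> polyfun g -> polyfun (fun t => f t * g t).
Proof. by move=> [p Hp] [q Hq]; exists (p * q) => t; rewrite hornerM Hp Hq. Qed.

Lemma polyfunXn f k : polyfun f -> polyfun (fun t => f t ^+ k).
Proof. by move=> [p Hp]; exists (p ^+ k) => t; rewrite horner_exp Hp. Qed.

Lemma polyfun_sum (I : Type) (s : seq I) (P : pred I) (F : I -> K -> K) :
  (forall i, polyfun (F i)) -> polyfun (fun t => \sum_(i <- s | P i) F i t).
Proof.
move=> HF; elim: s => [|i s [p Hp]].
  by exists 0 => t; rewrite big_nil horner0.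
have [q Hq] := HF i.
exists (if P i then q + p else p) => t; rewrite big_cons.
by case: ifP; rewrite Hp // hornerD Hq.
Qed.

Lemma polyfun_prod (I : Type) (s : seq I) (P : pred I) (F : I -> K -> K) :
  (forall i, polyfun (F i)) -> polyfun (fun t => \prod_(i <- s | P i) F i t).
Proof.
move=> HF; elim: s => [|i s [p Hp]].
  by exists 1 => t; rewrite big_nil hornerC.
have [q Hq] := HF i.
exists (if P i then q * p else p) => t; rewrite big_cons.
by case: ifP; rewrite Hp // hornerM Hq.
Qed.

Lemma polyfun_mulmx m n k (P : K -> 'M[K]_(m, n)) (Q : K -> 'M[K]_(n, k)) :
  (forall i j, polyfun (fun t => P t i j)) ->
  (forall i j, polyfun (fun t => Q t i j)) ->
  forall i j, polyfun (fun t => (P t *m Q t) i j).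
Proof.
move=> HP HQ i j.
have [p Hp] : polyfun (fun t => \sum_l P t i l * Q t l j).
  by apply: polyfun_sum => l; apply: polyfunM.
by exists p => t; rewrite mxE Hp.
Qed.

Lemma polyfun_line m n (A B : 'M[K]_(m, n)) i j :
  polyfun (fun t => (A + t *: (B - A)) i j).
Proof.
exists ((A i j)%:P + 'X * (B i j - A i j)%:P) => t.
by rewrite !mxE !hornerE.
Qed.

Lemma polyfun_det n (P : K -> 'M[K]_n) :
  (forall i j, polyfun (fun t => P t i j)) -> polyfun (fun t => \det (P t)).
Proof.
move=> HP; apply: polyfun_sum => s; apply: polyfunM; first exact: polyfunC.
by apply: polyfun_prod => i.
Qed.

(** The product of the two polynomials vanishes at every point, hence is zero, and the factor of [g]
    is not. *)
Lemma polyfun_eq0 f g t1 : polyfun f -> polyfun g -> g t1 != 0 ->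
  (forall t, g t != 0 -> f t = 0) -> forall t, f t = 0.
Proof.
move=> [p Hp] [q Hq] gt1 Hfg.
have /eqP : q * p = 0.
  apply: poly_fun_eq0 => t; rewrite hornerM -Hp -Hq.
  by have [->|/Hfg->] := eqVneq (g t) 0; rewrite ?mul0r ?mulr0.
rewrite mulf_eq0 => /orP[]/eqP q0.
  by move: gt1; rewrite Hq q0 horner0 eqxx.
by move=> t; rewrite Hp q0 horner0.
Qed.

End PolynomialFunctions.

(** * Independence of few monomials on the row space of a Vandermonde matrix *)

Section VandermondeSubspace.
Variables (K : closedFieldType) (n : nat).

Definition rowmon (v : 'I_n -> K) (e : 'rV[nat]_n) : K := \prod_j v j ^+ e 0 j.

(** Insert [(X - t j) * q + x], whose value at the node [t j] is [x]. Every term is divisible by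
    [x ^+ d]; after division, setting [x = 0] keeps exactly the terms of exponent [d] at [j]. The
    nodes may coincide, which is exploited later. *)
Lemma restrict_relation (t : 'I_n -> K) r (s : seq 'rV[nat]_n) (w : 'rV[nat]_n -> K)
    (j : 'I_n) d :
  (forall q : {poly K}, (size q <= r.+1)%N ->
     \sum_(e <- s) w e * rowmon (fun l => q.[t l]) e = 0) ->
  (forall e, e \in s -> (d <= e 0%R j)%N) ->
  forall q : {poly K}, (size q <= r)%N ->
     \sum_(e <- s | e 0 j == d)
        (w e * \prod_(l | l != j) (t l - t j) ^+ e 0 l)
        * rowmon (fun l => q.[t l]) e = 0.
Proof.
move=> rel dmin q sz_q.
pose u (l : 'I_n) x := (t l - t j) * q.[t l] + x.
pose phi x := \sum_(e <- s) w e * (x ^+ (e 0 j - d) * \prod_(l | l != j) u l x ^+ e 0 l).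
have Hphi : polyfun phi.
  apply: polyfun_sum => e; apply: polyfunM; first exact: polyfunC.
  apply: polyfunM; first by apply: polyfunXn; exact: polyfunX.
  apply: polyfun_prod => l; apply: polyfunXn; apply: polyfunD.
    exact: polyfunC.
  exact: polyfunX.
have phi0 : phi 0 = 0.
  apply: (@polyfun_eq0 K phi id 1 _ (@polyfunX K)) => //; first exact: oner_neq0.
  move=> x xn0; apply: (mulfI (expf_neq0 d xn0)); rewrite mulr0.
  pose qx := ('X - (t j)%:P) * q + x%:P.
  have sz_qx : (size qx <= r.+1)%N.
    apply: leq_trans (size_polyD _ _) _; rewrite geq_max; apply/andP; split.
      apply: leq_trans (size_polyMleq _ _) _.
      by rewrite size_XsubC.
    by apply: leq_trans (size_polyC_leq1 _) _.
  rewrite -[RHS](rel _ sz_qx) mulr_sumr; apply: eq_big_seq => e es.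
  rewrite mulrCA; congr (_ * _); rewrite mulrA -exprD subnKC ?dmin //.
  rewrite /rowmon [in RHS](bigD1 j) //=; congr (_ ^+ _ * _).
    by rewrite !hornerE subrr mul0r add0r.
  by apply: eq_bigr => l _; rewrite !hornerE.
(* Coordinate [j] was divided out; the factor [q.[t j] ^+ d], common to all remaining terms, puts it
   back. *)
transitivity (q.[t j] ^+ d * phi 0); last by rewrite phi0 mulr0.
rewrite /phi mulr_sumr big_mkcond /=; apply: eq_big_seq => e es.
case: ifP => [/eqP ej|ej]; last first.
  rewrite expr0n subn_eq0 leqNgt ltn_neqAle eq_sym ej dmin //=.
  by rewrite mul0r !mulr0.
have -> : rowmon (fun l => q.[t l]) e
    = q.[t j] ^+ d * \prod_(l | l != j) q.[t l] ^+ e 0 l.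
  by rewrite /rowmon (bigD1 j) //= ej.
rewrite ej subnn expr0 mul1r mulrCA; congr (_ * _); rewrite -mulrA; congr (_ * _).
by rewrite -big_split; apply: eq_bigr => l _; rewrite /u addr0 exprMn.
Qed.

Lemma ex_min_seq (T : eqType) (F : T -> nat) (s : seq T) x0 : x0 \in s ->
  exists2 x, x \in s & forall y, y \in s -> (F x <= F y)%N.
Proof.
elim: s x0 => // a s IH x0 _; case: s IH => [|b s] IH.
  by exists a; rewrite ?mem_head // => y; rewrite inE => /eqP->.
have [x xs Hx] := IH b (mem_head _ _).
case: (leqP (F a) (F x)) => ax; [exists a|exists x].
- exact: mem_head.
- by move=> y; rewrite inE => /predU1P[->//|/Hx]; apply: leq_trans.
- by rewrite inE xs orbT.
- by move=> y; rewrite inE => /predU1P[->|/Hx//]; apply: ltnW.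
Qed.

(** Induction on [r]. Among the terms of nonzero weight, two differ at some coordinate [j];
    restricting to the least exponent at [j] loses a term and lowers the degree bound by one, while
    distinct nodes keep the new weights nonzero. A single monomial is excluded by [q = 1]. *)
Lemma vandermonde_independent (t : 'I_n -> K) : injective t ->
  forall r (s : seq 'rV[nat]_n) (w : 'rV[nat]_n -> K), uniq s -> (size s <= r)%N ->
  (forall q : {poly K}, (size q <= r)%N ->
     \sum_(e <- s) w e * rowmon (fun l => q.[t l]) e = 0) ->
  forall e, e \in s -> w e = 0.
Proof.
move=> t_inj; elim=> [|r IH] s w us sz_s rel e0 e0s.
  by move: sz_s e0s; rewrite leqn0 size_eq0 => /eqP->.
apply/eqP; apply: contraT => we0.
pose s' := [seq e <- s | w e != 0].
have us' : uniq s' by rewrite filter_uniq.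
have sz_s' : (size s' <= r.+1)%N by rewrite size_filter (leq_trans (count_size _ _)).
have rel' (q : {poly K}) : (size q <= r.+1)%N ->
     \sum_(e <- s') w e * rowmon (fun l => q.[t l]) e = 0.
  move/rel => relq; rewrite big_filter big_mkcond -[RHS]relq; apply: eq_bigr => e _.
  by case: eqP => //= ->; rewrite mul0r.
have e0s' : e0 \in s' by rewrite mem_filter we0.
case: (boolP (all (pred1 e0) s')) => [/all_pred1P s'E|/allPn[e1 e1s' /= e10]].
  have sz1 : size s' = 1.
    move: us' e0s'; rewrite s'E; case: (size s') => [|[|k]] //=.
    by rewrite inE eqxx.
  have := rel' 1; rewrite size_poly1 s'E sz1 big_seq1 => /(_ isT) /eqP.
  rewrite mulf_eq0 (negPf we0) /= /rowmon big1 ?oner_eq0 // => j _.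
  by rewrite hornerC expr1n.
have [j e10j] : exists j, e1 0 j != e0 0 j.
  apply/existsP; apply: contraNT e10; rewrite negb_exists => /forallP H.
  by apply/eqP/rowP => j; apply/eqP; have := H j; rewrite negbK.
have [e2 e2s' e2min] := ex_min_seq (fun e : 'rV[nat]_n => e 0 j) e0s'.
have [e3 e3s' e3j] : exists2 e3, e3 \in s' & e3 0 j != e2 0 j.
  have [e0j|] := eqVneq (e0 0 j) (e2 0 j); last by exists e0.
  by exists e1; rewrite // -e0j.
have rel2 := restrict_relation rel' e2min.
pose w' (e : 'rV[nat]_n) := w e * \prod_(l | l != j) (t l - t j) ^+ e 0 l.
have /eqP : w' e2 = 0.
  apply: (IH [seq e : 'rV_n <- s' | e 0 j == e2 0 j] w').
  - by rewrite filter_uniq.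
  - rewrite -ltnS; apply: leq_trans sz_s'; rewrite size_filter ltn_neqAle count_size andbT.
    by rewrite -all_count; apply/allPn; exists e3.
  - by move=> q /rel2; rewrite big_filter.
  - by rewrite mem_filter eqxx.
rewrite mulf_eq0 => /orP[]; first by move: e2s'; rewrite mem_filter => /andP[/negPf->].
move/prodf_eq0 => [l lj]; rewrite expf_eq0 => /andP[_].
by rewrite subr_eq0 => /eqP/t_inj/eqP; rewrite (negPf lj).
Qed.

End VandermondeSubspace.

(** * Exponent vectors of one row in the extremal case *)

Section DependentRows.
Variables (K : closedFieldType) (n : nat).
Implicit Types (S : seq 'rV[nat]_n) (t : 'I_n -> K).

Definition relation_at r S t (w : 'rV[nat]_n -> K) :=
  forall q : {poly K}, (size q <= r)%N ->
    \sum_(e <- S) w e * rowmon (fun l => q.[t l]) e = 0.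

Definition dependent_at r S t :=
  exists2 w, relation_at r S t w & exists2 e, e \in S & w e != 0.

Definition row_unit d (j : 'I_n) : 'rV[nat]_n := \row_l (if l == j then d else 0%N).

Lemma row_unit_inj d : (0 < d)%N -> injective (row_unit d).
Proof.
move=> d0 j k /rowP/(_ j); rewrite !mxE eqxx.
by case: eqP => // _ d00; rewrite d00 in d0.
Qed.

Lemma relation_support r S t w : injective t -> uniq S -> relation_at r S t w ->
  (exists2 e, e \in S & w e != 0) -> (r < count (fun e => w e != 0%R) S)%N.
Proof.
move=> t_inj uS rel [e eS we]; rewrite ltnNge; apply/negP => le_r.
suff: w e = 0 by apply/eqP.
apply: (vandermonde_independent t_inj (s := [seq e <- S | w e != 0]) (r := r)).
- by rewrite filter_uniq.
- by rewrite size_filter.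
- move=> q /rel relq; rewrite big_filter big_mkcond -[RHS]relq; apply: eq_bigr => x _.
  by case: eqP => //= ->; rewrite mul0r.
- by rewrite mem_filter we.
Qed.

Lemma row_neq0 (e : 'rV[nat]_n) : e != const_mx 0%N -> exists j, (0 < e 0%R j)%N.
Proof.
move=> en0; apply/existsP; apply: contraNT en0; rewrite negb_exists => /forallP H.
by apply/eqP/rowP => j; apply/eqP; have := H j; rewrite mxE lt0n negbK.
Qed.

Lemma count_le1 (T : eqType) (a : pred T) (s : seq T) x y : (count a s <= 1)%N ->
  x \in s -> y \in s -> a x -> a y -> x = y.
Proof.
rewrite -size_filter => sz xs ys ax ay.
have: x \in [seq x <- s | a x] by rewrite mem_filter ax.
have: y \in [seq x <- s | a x] by rewrite mem_filter ay.
case: (filter a s) sz => [|z [|]] //= _.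
by rewrite !inE => /eqP-> /eqP->.
Qed.

Section Structure.
Variables (r : nat) (S : seq 'rV[nat]_n).
Hypotheses (r_ge2 : (2 <= r)%N) (uS : uniq S) (szS : size S = r.+1).
Hypothesis dep : forall t, dependent_at r S t.
Hypothesis S_min0 : forall j, exists2 e, e \in S & e 0 j = 0%N.

Lemma relation_full t w : injective t -> relation_at r S t w ->
  (exists2 e, e \in S & w e != 0) -> forall e, e \in S -> w e != 0.
Proof.
move=> t_inj rel ex; apply/allP; rewrite all_count eqn_leq count_size /= szS.
exact: relation_support rel ex.
Qed.

(** Restricting a relation to the monomials free of the variable [j] lowers the degree bound to
    [r - 1] and stays nontrivial, so at least [r] of the [r + 1] vectors in [S] vanish at [j]. *)
Lemma column_owner (j : 'I_n) e e' : e \in S -> e' \in S ->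
  (0 < e 0%R j)%N -> (0 < e' 0%R j)%N -> e = e'.
Proof.
have [t t_inj] := ex_inj_ord K n.
have [w rel ex] := dep t.
have wn0 := relation_full t_inj rel ex.
move=> eS e'S ej e'j; apply: (count_le1 (a := fun e : 'rV_n => (0 < e 0%R j)%N) _ eS e'S) => //.
case: r r_ge2 szS rel => // r' r'_ge1 sz rel.
have rel' := restrict_relation rel (j := j) (d := 0) (fun e _ => leq0n _).
pose w' (e : 'rV[nat]_n) := w e * \prod_(l | l != j) (t l - t j) ^+ e 0 l.
have w'n0 x : x \in S -> w' x != 0.
  move=> xS; rewrite mulf_neq0 ?wn0 //; apply/prodf_neq0 => l lj.
  by rewrite expf_neq0 // subr_eq0 (inj_eq t_inj).
pose S0 := [seq e : 'rV[nat]_n <- S | e 0 j == 0%N].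
have uS0 : uniq S0 by rewrite filter_uniq.
have relS0 : relation_at r' S0 t w' by move=> q /rel'; rewrite big_filter.
have : (r' < count (fun e => w' e != 0%R) S0)%N.
  apply: relation_support relS0 _ => //.
  by have [x xS xj] := S_min0 j; exists x; rewrite ?w'n0 // mem_filter xj eqxx.
move=> /leq_trans/(_ (count_size _ _)); rewrite size_filter.
have := count_predC (fun e : 'rV[nat]_n => e 0 j == 0%N) S; rewrite sz.
rewrite (eq_count (a1 := predC _) (a2 := fun e : 'rV[nat]_n => (0 < e 0%R j)%N)); last first.
  by move=> x /=; rewrite lt0n.
by move=> cE cr; rewrite -(leq_add2l r'.+1) addn1 -cE leq_add2r.
Qed.

(** The choice [q = 0] kills all monomials but the constant one, whose weight would then be zero. *)
Lemma row_exponent_neq0 e : e \in S -> exists j, (0 < e 0%R j)%N.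
Proof.
move=> eS; apply: row_neq0; apply: contraL eS => /eqP->; apply/negP => S0.
have [t t_inj] := ex_inj_ord K n.
have [w rel ex] := dep t.
have := rel 0; rewrite size_poly0 => /(_ isT).
rewrite (bigD1_seq _ S0 uS) /= big1_seq => [|x /andP[xn0 xS]]; last first.
  have [j xj] := row_neq0 xn0.
  by rewrite /rowmon (bigD1 j) //= horner0 expr0n (gtn_eqF xj) mul0r mulr0.
rewrite addr0 /rowmon big1 ?mulr1 => [|j _]; last by rewrite mxE expr0.
by apply/eqP; exact: relation_full t_inj rel ex _ S0.
Qed.

(* Specialize t at two equal nodes: the monomials merge, and only the two
   owners of these nodes can survive the restriction to that node. *)
Lemma row_exponent_pair e0 e1 (l0 l1 : 'I_n) : e0 \in S -> e1 \in S -> e0 != e1 ->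
  (0 < e0 0%R l0)%N -> (0 < e1 0%R l1)%N ->
  e0 = row_unit (e0 0 l0) l0 /\ e1 = row_unit (e0 0 l0) l1.
Proof.
move=> e0S e1S e01 e0l e1l.
have l01 : l0 != l1.
  apply: contraNneq e01 => l01; apply/eqP/(@column_owner l0) => //.
  by rewrite l01.
have [e0l1 e1l0] : e0 0 l1 = 0%N /\ e1 0 l0 = 0%N.
  split; apply/eqP; rewrite -leqn0 leqNgt; apply: contraNN e01 => pos; apply/eqP.
    exact: (@column_owner l1).
  exact: (@column_owner l0).
have other e : e \in S -> e != e0 -> e != e1 -> e 0 l0 = 0%N /\ e 0 l1 = 0%N.
  move=> eS ee0 ee1; split; apply/eqP; rewrite -leqn0 leqNgt.
    by apply: contraNN ee0 => pos; apply/eqP; exact: (@column_owner l0).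
  by apply: contraNN ee1 => pos; apply/eqP; exact: (@column_owner l1).
have [t0 t0_inj] := ex_inj_ord K n.
pose t l := if l == l1 then t0 l0 else t0 l.
have [w rel [ew ewS ewn0]] := dep t.
pose S1 := [seq e <- S | (e != e0) && (e != e1)].
have uS1 : uniq S1 by rewrite filter_uniq.
(* Restriction at [l0] with exponent 0 kills [e0], which is positive there, and [e1], whose new
   weight contains [t l1 - t l0 = 0]. The at most [r - 1] other monomials are independent. *)
have wS1 e : e \in S1 -> w e = 0.
  case: r r_ge2 szS rel => // r' _ sz rel eS1.
  have rel' := restrict_relation rel (j := l0) (d := 0) (fun e _ => leq0n _).
  pose w' (e : 'rV[nat]_n) := w e * \prod_(l | l != l0) (t l - t l0) ^+ e 0 l.
  have /eqP : w' e = 0.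
    apply: (vandermonde_independent t0_inj (s := S1) (r := r')) => //.
      have : (size S1 + 2 <= r'.+2)%N.
        rewrite -sz -(count_predC (fun e => (e != e0) && (e != e1)) S) size_filter leq_add2l.
        rewrite -size_filter; apply: (uniq_leq_size (s1 := [:: e0; e1])).
          by rewrite /= inE e01.
        move=> x; rewrite !inE mem_filter /= => /orP[]/eqP->; rewrite eqxx ?e0S ?e1S //.
        by rewrite andbF.
      by rewrite addn2 !ltnS.
    move=> q sz_q; rewrite -[RHS](rel' q sz_q) /S1 big_filter big_mkcond [RHS]big_mkcond.
    apply: eq_big_seq => x xS /=.
    have [->|xe0 /=] := eqVneq x e0; first by rewrite /= (gtn_eqF e0l).
    have [->|xe1 /=] := eqVneq x e1.
      rewrite e1l0 eqxx (bigD1 l1) 1?eq_sym //= /t eqxx (negPf l01) subrr expr0n.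
      by rewrite (gtn_eqF e1l) !(mul0r, mulr0).
    have [xl0 xl1] := other _ xS xe0 xe1; rewrite xl0 eqxx; congr (_ * _).
    apply: eq_bigr => l _; rewrite /t; case: eqP => // ->.
    by rewrite xl1 !expr0.
  rewrite mulf_eq0 => /orP[/eqP//|] /prodf_eq0[l ll0].
  move: eS1; rewrite mem_filter -andbA => /and3P[ee0 ee1 eS].
  have [_ el1] := other _ eS ee0 ee1.
  rewrite expf_eq0 /t (negPf l01) subr_eq0.
  have [->|_] := eqVneq l l1; first by rewrite el1.
  by rewrite (inj_eq t0_inj) (negPf ll0) andbF.
pose mg (e : 'rV[nat]_n) : 'rV[nat]_n :=
  \row_l (if l == l1 then 0%N else if l == l0 then (e 0%R l0 + e 0%R l1)%N else e 0 l).
have mgE (q : {poly K}) e : rowmon (fun l => q.[t l]) e = rowmon (fun l => q.[t0 l]) (mg e).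
  rewrite /rowmon (bigD1 l1) //= (bigD1 l0) //= [RHS](bigD1 l1) //= [in RHS](bigD1 l0) //=.
  rewrite !mxE !eqxx (negPf l01) /t eqxx (negPf l01) expr0 mul1r exprD mulrCA mulrA.
  congr (_ * _); apply: eq_bigr => l /andP[ll1 ll0].
  by rewrite mxE (negPf ll0) (negPf ll1).
have rel2 (q : {poly K}) : (size q <= r)%N ->
    w e0 * rowmon (fun l => q.[t0 l]) (mg e0) + w e1 * rowmon (fun l => q.[t0 l]) (mg e1) = 0.
  move=> sz_q; rewrite -[RHS](rel q sz_q) (bigD1_seq e0) //=; congr (_ + _).
    by rewrite mgE.
  rewrite -big_filter (bigD1_seq e1) /= ?filter_uniq //; last first.
    by rewrite mem_filter e1S eq_sym e01.
  rewrite mgE big1_seq ?addr0 // => x /andP[xe1]; rewrite mem_filter => /andP[xe0 xS].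
  by rewrite wS1 ?mul0r // mem_filter xe0 xe1.
(* As [r] is at least 2, two different merged monomials would be independent, making all weights
   zero. *)
have mg01 : mg e0 = mg e1.
  apply/eqP; apply: contraT => mgn.
  pose w2 x := if x == mg e0 then w e0 else w e1.
  have H x : x \in [:: mg e0; mg e1] -> w2 x = 0.
    apply: (vandermonde_independent t0_inj (s := [:: mg e0; mg e1]) (r := r)) => //.
      by rewrite /= inE mgn.
    move=> q /rel2; rewrite big_cons big_seq1 /w2 eqxx eq_sym (negPf mgn) //.
  have w0 : w e0 = 0 by have := H (mg e0); rewrite inE eqxx /w2 eqxx => ->.
  have w1 : w e1 = 0.
    by have := H (mg e1); rewrite !inE eqxx orbT /w2 eq_sym (negPf mgn) => ->.
  suff : w ew = 0 by move/eqP; rewrite (negPf ewn0).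
  have [->//|ee0] := eqVneq ew e0; have [->//|ee1] := eqVneq ew e1.
  by rewrite wS1 // mem_filter ee0 ee1.
have mgl l : mg e0 0 l = mg e1 0 l by rewrite mg01.
(* Away from [l0] and [l1] merging changes nothing, so a positive entry would be shared by [e0] and
   [e1], against [column_owner]. *)
have off l : l != l0 -> l != l1 -> e0 0 l = 0%N /\ e1 0 l = 0%N.
  move=> ll0 ll1; have := mgl l; rewrite !mxE (negPf ll0) (negPf ll1) => E.
  suff: e0 0 l = 0%N by rewrite -E.
  apply/eqP; rewrite -leqn0 leqNgt; apply: contraNN e01 => pos; apply/eqP.
  by apply: (@column_owner l) => //; rewrite -E.
have := mgl l0; rewrite !mxE eqxx (negPf l01) e0l1 e1l0 addn0 add0n => e1E.
split; apply/rowP => l; rewrite mxE; case: eqP => [->//|/eqP ll].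
  by have [->|/(off _ ll)[]//] := eqVneq l l1.
by have [->//|ll0] := eqVneq l l0; have [] := off _ ll0 ll.
Qed.

(** The exponent [d] is read off one fixed [e0]; comparing each other vector with [e0] through
    [row_exponent_pair] shows that it is a pure power with the same exponent. *)
Lemma dependent_rows_structure : exists d (J : {set 'I_n}),
  [/\ (0 < d)%N, #|J| = r.+1,
      forall e, e \in S -> exists2 j, j \in J & e = row_unit d j &
      forall j, j \in J -> row_unit d j \in S].
Proof.
case ES : S szS => [|e0 [|e1 S']] // sz; first by case: r r_ge2 sz.
have e0S : e0 \in S by rewrite ES mem_head.
have e1S : e1 \in S by rewrite ES !inE eqxx orbT.
have e10 : e1 != e0 by move: uS; rewrite ES /= inE eq_sym; case: eqP.
rewrite -ES; have [l0 e0l] := row_exponent_neq0 e0S.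
pose d := e0 0 l0; pose J := [set j | row_unit d j \in S].
have H e : e \in S -> exists2 j, j \in J & e = row_unit d j.
  move=> eS; suff [j ej] : exists j, e = row_unit d j by exists j; rewrite // inE -ej.
  have [->|ne] := eqVneq e e0.
    have [l1 e1l] := row_exponent_neq0 e1S; exists l0.
    by rewrite eq_sym in e10; have [] := row_exponent_pair e0S e1S e10 e0l e1l.
  have [l el] := row_exponent_neq0 eS; exists l; rewrite eq_sym in ne.
  by have [] := row_exponent_pair e0S eS ne e0l el.
exists d, J; split=> // [|j]; last by rewrite inE.
rewrite -szS cardE -(size_map (row_unit d)).
apply/perm_size/uniq_perm => // [|e].
  by rewrite map_inj_uniq ?enum_uniq //; exact: row_unit_inj.
apply/mapP/idP => [[j]|/H[j jJ ->]]; first by rewrite mem_enum inE => ? ->.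
by exists j; rewrite ?mem_enum.
Qed.

End Structure.
End DependentRows.

(** * Sums over lists, finite choice and rank factorization *)

Lemma partition_big_undup_map (R : Type) (idx : R) (op : Monoid.com_law idx)
    (I J : eqType) (s : seq I) (f : I -> J) (F : I -> R) :
  \big[op/idx]_(x <- s) F x
  = \big[op/idx]_(y <- undup (map f s)) \big[op/idx]_(x <- s | f x == y) F x.
Proof.
under [RHS]eq_bigr => y _ do rewrite big_mkcond.
rewrite exchange_big /=; apply: eq_big_seq => x xs.
rewrite (bigD1_seq (f x)) ?undup_uniq ?mem_undup ?map_f //= eqxx.
by rewrite big1 ?Monoid.mulm1 // => y; rewrite eq_sym => /negPf->.
Qed.

Lemma mem_choice (T : eqType) (U : Type) (u0 : U) (s : seq T) (P : T -> U -> Prop) :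
  (forall x, x \in s -> exists u, P x u) -> exists f, forall x, x \in s -> P x (f x).
Proof.
elim: s => [|a s IH] H; first by exists (fun=> u0).
have [f Hf] := IH (fun x xs => H x (mem_behead (s := a :: s) xs)).
have [u Hu] := H a (mem_head _ _).
exists (fun x => if x == a then u else f x) => x; rewrite inE.
by case: eqVneq => [->//|_ /Hf].
Qed.

Lemma mxrank_factor (K : fieldType) m n r (A : 'M[K]_(m, n)) : (\rank A <= r)%N ->
  exists (P : 'M_(m, r)) (Q : 'M_(r, n)), A = P *m Q.
Proof.
move=> rA; exists (col_ebase A *m pid_mx (\rank A)), (pid_mx (\rank A) *m row_ebase A).
rewrite mulmxA -(mulmxA (col_ebase A)) mul_pid_mx minnn (minn_idPr rA).
by rewrite mulmx_ebase.
Qed.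

(** * Limits along a curve *)

Section ValuationLimit.
Variable K : closedFieldType.

(** While all the polynomials vanish at 0, divide each of them by the indeterminate. This stops,
    since each division lowers the degree of the nonzero polynomial [p e0]. *)
Lemma polyfun_min_valuation (T : eqType) (S : seq T) (h : T -> K -> K) e0 x0 :
  (forall e, polyfun (h e)) -> e0 \in S -> h e0 x0 != 0 ->
  exists N (p : T -> {poly K}),
    (forall e x, e \in S -> h e x = x ^+ N * (p e).[x]) /\
    exists2 e, e \in S & (p e).[0] != 0.
Proof.
move=> hP e0S he0.
have [p pP] := mem_choice 0 (fun e (_ : e \in S) => hP e).
have : p e0 != 0 by apply: contraNneq he0 => p0; rewrite pP // p0 horner0.
have [k] := ubnP (size (p e0)).
elim: k h p {hP he0} pP => // k IH h p pP sz_p p0.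
case: (boolP (all (fun e => (p e).[0] == 0) S)) => [/allP root0|/allPn[e eS pe]]; last first.
  exists 0%N, p; split; last by exists e.
  by move=> e1 x e1S; rewrite expr0 mul1r pP.
have [p' p'P] : exists p', forall e, e \in S -> p e = p' e * 'X.
  apply: (@mem_choice _ _ 0 S (fun e q => p e = q * 'X)) => e /root0.
  rewrite -rootE => /factor_theorem[q ->].
  by exists q; rewrite polyC0 subr0.
have p'0 : p' e0 != 0 by apply: contraNneq p0 => p'0; rewrite p'P // p'0 mul0r.
have [|N [q [qE ex]]] := IH (fun e x => (p' e).[x]) p' (fun _ _ _ => erefl) _ p'0.
  by move: sz_p; rewrite p'P // size_mulX // ltnS.
exists N.+1, q; split=> // e x eS.
by rewrite pP // p'P // hornerMX qE // exprS mulrC mulrA.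
Qed.

End ValuationLimit.

(** * Sparse sums, their row fibers and the lower bound on the number of terms *)

Definition mon (R : comNzRingType) m n (A : 'M[R]_(m, n)) (M : 'M[nat]_(m, n)) : R :=
  \prod_i \prod_j A i j ^+ M i j.

Section SparseSums.
Variable K : closedFieldType.
Implicit Types m n r : nat.

(* A polynomial is encoded by the list s of its exponent matrices, with
   coefficients c. *)
Definition ev m n (s : seq 'M[nat]_(m, n)) (c : 'M[nat]_(m, n) -> K) (A : 'M[K]_(m, n)) : K :=
  \sum_(M <- s) c M * mon A M.

Definition vanishes m n r (s : seq 'M[nat]_(m, n)) (c : 'M[nat]_(m, n) -> K) :=
  forall A : 'M[K]_(m, n), (\rank A <= r)%N -> ev s c A = 0.

(** The terms of [f_e y^e] when the polynomial is sorted by its [i]-th row. *)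
Definition fiber m n (s : seq 'M[nat]_(m, n)) (i : 'I_m) (e : 'rV[nat]_n) :=
  [seq M <- s | row i M == e].

Definition row_exps m n (s : seq 'M[nat]_(m, n)) (i : 'I_m) := undup (map (row i) s).

Definition set_row m n (A : 'M[K]_(m, n)) (i : 'I_m) (y : 'rV[K]_n) : 'M[K]_(m, n) :=
  \matrix_(k, j) (if k == i then y 0 j else A k j).

Definition mon_off m n (A : 'M[K]_(m, n)) (i : 'I_m) (M : 'M[nat]_(m, n)) : K :=
  \prod_(k | k != i) \prod_j A k j ^+ M k j.

Lemma mon_row m n (A : 'M[K]_(m, n)) i M :
  mon A M = rowmon (A i) (row i M) * mon_off A i M.
Proof.
rewrite /mon (bigD1 i) //=; congr (_ * _).
by apply: eq_bigr => j _; rewrite mxE.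
Qed.

Lemma mon_set_row m n (A : 'M[K]_(m, n)) i y M :
  mon (set_row A i y) M = rowmon (y 0) (row i M) * mon_off A i M.
Proof.
rewrite (mon_row _ i); congr (_ * _).
  by apply: eq_bigr => j _; rewrite mxE eqxx.
by apply: eq_bigr => k ki; apply: eq_bigr => j _; rewrite mxE (negPf ki).
Qed.

Lemma set_row_mul m n r (P : 'M[K]_(m, r)) (Q : 'M[K]_(r, n)) i y :
  set_row (P *m Q) i (y *m Q) = set_row P i y *m Q.
Proof.
apply/matrixP => k j; rewrite !mxE; case: eqP => [->|/eqP ki].
  by apply: eq_bigr => l _; rewrite mxE eqxx.
by apply: eq_bigr => l _; rewrite mxE (negPf ki).
Qed.

Lemma rank_set_row m n (A : 'M[K]_(m, n)) i y : (\rank (set_row A i y) <= (\rank A).+1)%N.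
Proof.
have -> : set_row A i y = A + delta_mx i 0 *m (y - row i A).
  apply/matrixP => k j; rewrite !mxE big_ord1 !mxE eqxx andbT.
  by case: eqP => [->|_]; rewrite ?mul1r ?mul0r ?addr0 // addrC subrK.
apply: leq_trans (mxrank_add _ _) _; rewrite -[leqRHS]addn1 leq_add2l.
exact: mulmx_max_rank.
Qed.

Lemma ev_set_row m n s c (A : 'M[K]_(m, n)) i y :
  ev s c (set_row A i y) = \sum_(e <- row_exps s i)
    (\sum_(M <- s | row i M == e) c M * mon_off A i M) * rowmon (y 0) e.
Proof.
rewrite /ev (partition_big_undup_map _ _ (row i)) /=; apply: eq_bigr => e _.
rewrite mulr_suml; apply: eq_bigr => M /eqP<-.
by rewrite mon_set_row mulrAC -!mulrA.
Qed.

Lemma ev_fiber m n s c (A : 'M[K]_(m, n)) i e :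
  ev (fiber s i e) c A
  = rowmon (A i) e * \sum_(M <- s | row i M == e) c M * mon_off A i M.
Proof.
rewrite /ev /fiber big_filter mulr_sumr; apply: eq_bigr => M /eqP<-.
by rewrite (mon_row _ i) mulrCA.
Qed.

Lemma size_fibers m n (s : seq 'M[nat]_(m, n)) i :
  size s = \sum_(e <- row_exps s i) size (fiber s i e).
Proof.
rewrite -sum1_size (partition_big_undup_map _ _ (row i)) /=; apply: eq_bigr => e _.
by rewrite /fiber size_filter -sum1_count.
Qed.

Lemma mem_row_exps m n (s : seq 'M[nat]_(m, n)) i e :
  reflect (exists2 M, M \in s & e = row i M) (e \in row_exps s i).
Proof. by rewrite mem_undup; apply: mapP. Qed.

Lemma fiber_neq0 m n (s : seq 'M[nat]_(m, n)) i e :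
  (e \in row_exps s i) = (fiber s i e != [::]).
Proof.
apply/mem_row_exps/idP => [[M Ms ->]|].
  by rewrite -size_eq0 -lt0n size_filter -has_count; apply/hasP; exists M.
rewrite -size_eq0 -lt0n size_filter -has_count => /hasP[M Ms /eqP<-].
by exists M.
Qed.

(** With the other rows fixed, the evaluation is a polynomial in a free row [y]; taking as degree
    bound the number of its monomials makes them independent. *)
Lemma row_coef_eq0 m n s c (A : 'M[K]_(m, n)) i :
  (forall y, ev s c (set_row A i y) = 0) ->
  forall e, \sum_(M <- s | row i M == e) c M * mon_off A i M = 0.
Proof.
move=> ev0 e; have [t t_inj] := ex_inj_ord K n.
have [eS|] := boolP (e \in row_exps s i); last first.
  by rewrite fiber_neq0 negbK -big_filter => /eqP; rewrite /fiber => ->; rewrite big_nil.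
apply: (vandermonde_independent t_inj (s := row_exps s i) (r := size (row_exps s i))
          (w := fun e => \sum_(M <- s | row i M == e) c M * mon_off A i M)) => //.
  exact: undup_uniq.
move=> q _; rewrite -[RHS](ev0 (\row_l q.[t l])) ev_set_row; apply: eq_bigr => x _.
by congr (_ * _); apply: eq_bigr => j _; rewrite mxE.
Qed.

(* Below the critical rank, the i-th row of the matrix is arbitrary. *)
Lemma fiber_vanishes_lower m n r (s : seq 'M[nat]_(m, n)) c i e :
  vanishes r.+1 s c -> vanishes r (fiber s i e) c.
Proof.
move=> van A rA; rewrite ev_fiber row_coef_eq0 ?mulr0 // => y.
by apply: van; apply: leq_trans (rank_set_row _ _ _) _.
Qed.

Lemma horner_vandermonde n r (t : 'I_n -> K) (q : {poly K}) j : (size q <= r)%N ->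
  (poly_rV q *m \matrix_(k < r, l < n) t l ^+ k) 0 j = q.[t j].
Proof.
move=> sz_q; rewrite (horner_coef_wide _ sz_q) mxE.
by apply: eq_bigr => k _; rewrite !mxE.
Qed.

Lemma polyfun_mon_off m n (P : K -> 'M[K]_(m, n)) i M :
  (forall k j, polyfun (fun x => P x k j)) -> polyfun (fun x => mon_off (P x) i M).
Proof.
by move=> HP; apply: polyfun_prod => k; apply: polyfun_prod => j; apply: polyfunXn.
Qed.

(* Write A = P0 *m Q0 with a nonzero row coefficient at A. Moving the row space
   along the line from the row space B of the Vandermonde matrix to Q0, the row
   coefficients give a relation between the monomials on the row space, and
   dividing by a power of the parameter makes it survive in the limit B. *)
Lemma row_exps_dependent m n r (s : seq 'M[nat]_(m, n)) c i e0 A :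
  vanishes r s c -> (\rank A <= r)%N -> ev (fiber s i e0) c A != 0 ->
  forall t : 'I_n -> K, dependent_at r (row_exps s i) t.
Proof.
move=> van rA evA t; have [P0 [Q0 defA]] := mxrank_factor rA.
pose B : 'M[K]_(r, n) := \matrix_(k, l) t l ^+ k.
pose Q x := B + x *: (Q0 - B).
have Q1 : Q 1 = Q0 by rewrite /Q scale1r addrC subrK.
have QB : Q 0 = B by rewrite /Q scale0r addr0.
have QP k j : polyfun (fun x => Q x k j) by exact: polyfun_line.
pose h e x := \sum_(M <- s | row i M == e) c M * mon_off (P0 *m Q x) i M.
have hP e : polyfun (h e).
  apply: polyfun_sum => M; apply: polyfunM; first exact: polyfunC.
  apply: polyfun_mon_off => k j; apply: polyfun_mulmx => // k' j'; exact: polyfunC.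
have rel x (v : 'rV_r) : \sum_(e <- row_exps s i) h e x * rowmon ((v *m Q x) 0) e = 0.
  by rewrite -ev_set_row set_row_mul; apply: van; apply: mulmx_max_rank.
have e0S : e0 \in row_exps s i.
  by rewrite fiber_neq0; apply: contraNneq evA => ->; rewrite /ev big_nil.
have he0 : h e0 1 != 0.
  by apply: contraNneq evA; rewrite ev_fiber /h Q1 -defA => ->; rewrite mulr0.
have [N [p [hE ex]]] := polyfun_min_valuation hP e0S he0.
exists (fun e => (p e).[0]) => // q sz_q.
pose phi x := \sum_(e <- row_exps s i) (p e).[x] * rowmon ((poly_rV q *m Q x) 0) e.
transitivity (phi 0).
  apply: eq_bigr => e _; congr (_ * _); apply: eq_bigr => j _.
  by rewrite QB horner_vandermonde.
apply: (@polyfun_eq0 K phi id 1 _ (@polyfunX K)) => //; first 1 last.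
- exact: oner_neq0.
- move=> x xn0; apply: (mulfI (expf_neq0 N xn0)); rewrite mulr0 -[RHS](rel x (poly_rV q)).
  by rewrite mulr_sumr; apply: eq_big_seq => e eS; rewrite hE // mulrA.
apply: polyfun_sum => e; apply: polyfunM; first by exists (p e).
apply: polyfun_prod => j; apply: polyfunXn; apply: polyfun_mulmx => // k l.
exact: polyfunC.
Qed.

Lemma fibers_vanish m n r (s : seq 'M[nat]_(m, n)) c i :
  vanishes r s c -> (size (row_exps s i) <= r)%N -> forall e, vanishes r (fiber s i e) c.
Proof.
move=> van sz e A rA; apply/eqP/negPn/negP => evA.
have [t t_inj] := ex_inj_ord K n.
have [w rel ex] := row_exps_dependent van rA evA t.
have := relation_support t_inj (undup_uniq _) rel ex.
by rewrite ltnNge (leq_trans (count_size _ _)).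
Qed.

Lemma rank_const1 m n r : (\rank (const_mx 1%R : 'M[K]_(m, n)) <= r.+1)%N.
Proof.
have -> : const_mx 1 = (const_mx 1 : 'cV[K]_m) *m (const_mx 1 : 'rV[K]_n).
  by apply/matrixP => i j; rewrite !mxE big_ord1 !mxE mulr1.
exact: leq_trans (mulmx_max_rank _ _) _.
Qed.

Lemma mon_const1 m n (M : 'M[nat]_(m, n)) : mon (const_mx 1) M = 1 :> K.
Proof. by apply: big1 => i _; apply: big1 => j _; rewrite mxE expr1n. Qed.

(** Induction on [r], then on the rows. With too few terms every row has too few exponents for a
    dependence, so by [fibers_vanish] its fibers vanish in the same rank. Passing to fibers row by
    row ends with a single monomial, which is 1 at the all-ones matrix. *)
Theorem vanishes_many_terms m n r (s : seq 'M[nat]_(m, n)) c :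
  uniq s -> (forall M, M \in s -> c M != 0) -> s != [::] -> vanishes r s c ->
  ((r.+1)`! <= size s)%N.
Proof.
elim: r s => [|r IHr] s us cn0 s0 van; first by rewrite lt0n size_eq0.
(* The first [k] rows are still to be treated: the terms of [s'] agree on all later ones. *)
have Hk k (s' : seq 'M[nat]_(m, n)) : {subset s' <= s} -> uniq s' -> s' != [::] ->
    vanishes r.+1 s' c ->
    (forall M N (i : 'I_m), M \in s' -> N \in s' -> (k <= i)%N -> row i M = row i N) ->
    ((r.+2)`! <= size s')%N.
  elim: k s' => [|k IHk] s' ss us' s'0 van' rowk.
    case Es: s' s'0 => [//|M s''] _.
    have s''0 : s'' = [::].
      case Es'' : s'' => [//|N s3].
      have : M = N.
        apply/row_matrixP => i; apply: rowk => //; rewrite Es Es'' !inE eqxx //.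
        by rewrite orbT.
      by move: us'; rewrite Es Es'' /= => /andP[]; rewrite inE negb_or => /andP[/eqP].
    have := van' _ (rank_const1 m n r); rewrite /ev Es s''0 big_seq1 mon_const1 mulr1.
    by move/eqP; rewrite (negPf (cn0 _ _)) // ss // Es mem_head.
  case: (ltnP k m) => km; last first.
    apply: IHk => // M N i _ _ ki.
    by have := ltn_ord i; rewrite ltnNge (leq_trans km ki).
  pose i := Ordinal km.
  rewrite leqNgt; apply/negP => sz_lt.
  (* Each nonempty fiber vanishes in rank [r] and so has at least [(r+1)!] terms; fewer than
     [(r+2)!] terms in all leave at most [r + 1] fibers. *)
  have fib e : vanishes r.+1 (fiber s' i e) c.
    apply: fibers_vanish => //; rewrite -ltnS -(ltn_pmul2r (fact_gt0 r.+1)) -factS.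
    apply: leq_ltn_trans sz_lt; rewrite (size_fibers s' i) -sum1_size big_distrl /=.
    rewrite big_seq [leqRHS]big_seq; apply: leq_sum => e0 e0S; rewrite mul1n.
    apply: IHr; rewrite ?filter_uniq -?fiber_neq0 //.
      by move=> M; rewrite mem_filter => /andP[_ /ss/cn0].
    exact: fiber_vanishes_lower.
  have [M Ms] : exists M, M \in s'.
    by case: (s') s'0 => // M s'' _; exists M; rewrite mem_head.
  have : ((r.+2)`! <= size (fiber s' i (row i M)))%N.
    apply: IHk; rewrite ?filter_uniq //.
    - by move=> N; rewrite mem_filter => /andP[_ /ss].
    - by rewrite -fiber_neq0; apply/mem_row_exps; exists M.
    move=> N1 N2 j; rewrite !mem_filter => /andP[/eqP N1i N1s] /andP[/eqP N2i N2s].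
    rewrite leq_eqVlt => /predU1P[kj|]; last exact: rowk.
    by have -> : j = i by [exact: val_inj]; rewrite N1i N2i.
  by rewrite leqNgt (leq_trans _ sz_lt) // ltnS size_filter count_size.
by apply: (Hk m) => // M N i _ _; rewrite leqNgt ltn_ord.
Qed.

End SparseSums.

(** * Identifying two columns *)

Section ColumnMerge.
Variable K : closedFieldType.

Definition merge_col m n (l l' : 'I_n) (M : 'M[nat]_(m, n)) : 'M[nat]_(m, n) :=
  \matrix_(i, j) (if j == l' then 0%N
                  else if j == l then (M i l + M i l')%N else M i j).

Definition copy_col m n (l l' : 'I_n) (A : 'M[K]_(m, n)) : 'M[K]_(m, n) :=
  \matrix_(i, j) A i (if j == l' then l else j).

Lemma rank_copy_col m n l l' (A : 'M[K]_(m, n)) : (\rank (copy_col l l' A) <= \rank A)%N.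
Proof.
have -> : copy_col l l' A = A *m \matrix_(k, j) (k == if j == l' then l else j)%:R.
  apply/matrixP => i j; rewrite !mxE; set l1 := if _ then _ else _.
  rewrite (bigD1 l1) //= mxE eqxx mulr1 big1 ?addr0 // => k kl1.
  by rewrite mxE (negPf kl1) mulr0.
exact: mxrankM_maxl.
Qed.

Lemma mon_copy_col m n l l' (A : 'M[K]_(m, n)) M : l != l' ->
  mon (copy_col l l' A) M = mon A (merge_col l l' M).
Proof.
move=> ll'; apply: eq_bigr => i _.
rewrite (bigD1 l') //= (bigD1 l) //= [RHS](bigD1 l') //= [in RHS](bigD1 l) //=.
rewrite !mxE !eqxx (negPf ll') expr0 mul1r exprD mulrCA mulrA.
congr (_ * _); apply: eq_bigr => j /andP[jl' jl].
by rewrite !mxE (negPf jl') (negPf jl).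
Qed.

Definition merge_coef m n (l l' : 'I_n) (s : seq 'M[nat]_(m, n)) (c : 'M[nat]_(m, n) -> K) N :=
  \sum_(M <- s | merge_col l l' M == N) c M.

(** Terms that cancel under the identification are dropped, so that the lower bound on the number of
    terms applies. *)
Definition merge_supp m n (l l' : 'I_n) (s : seq 'M[nat]_(m, n)) (c : 'M[nat]_(m, n) -> K) :=
  [seq N <- undup (map (merge_col l l') s) | merge_coef l l' s c N != 0].

Lemma merge_vanishes m n r l l' (s : seq 'M[nat]_(m, n)) c : l != l' ->
  vanishes r s c -> vanishes r (merge_supp l l' s c) (merge_coef l l' s c).
Proof.
move=> ll' van A rA; rewrite -(van (copy_col l l' A)); last first.
  exact: leq_trans (rank_copy_col _ _ _) rA.
rewrite /ev [RHS](partition_big_undup_map _ _ (merge_col l l')) /= big_filter big_mkcond.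
apply: eq_bigr => N _; transitivity (merge_coef l l' s c N * mon A N).
  by case: eqP => //= ->; rewrite mul0r.
rewrite mulr_suml; apply: eq_bigr => M /eqP<-.
by rewrite mon_copy_col.
Qed.

Lemma mem_merge_supp m n l l' (s : seq 'M[nat]_(m, n)) c N :
  N \in merge_supp l l' s c -> exists2 M, M \in s & N = merge_col l l' M.
Proof. by rewrite mem_filter mem_undup => /andP[_ /mapP]. Qed.

End ColumnMerge.

Lemma merge_row_unit m n (l l' j : 'I_n) d (i : 'I_m) M : l != l' -> row i M = row_unit d j ->
  row i (merge_col l l' M) = row_unit d (if j == l' then l else j).
Proof.
move=> ll' /rowP rM; apply/rowP => k; rewrite !mxE.
have Mi h : M i h = if h == j then d else 0%N by have := rM h; rewrite !mxE.
rewrite !Mi; have [->|jl'] := eqVneq j l'.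
  rewrite ?eqxx (negPf ll') ?add0n; have [->|//] := eqVneq k l'.
  by rewrite eq_sym (negPf ll').
have [->|kl'] := eqVneq k l'; first by rewrite eq_sym (negPf jl').
by rewrite 1?(eq_sym l' j) 1?(negPf jl') addn0; have [->|] := eqVneq k l.
Qed.

(** * Structure of the sums with the minimal number of terms *)

Section ShortSums.
Variable K : closedFieldType.
Implicit Types m n r : nat.

(** By the last clause no variable divides all terms: the common monomial has been removed. *)
Definition extremal m n r (s : seq 'M[nat]_(m, n)) (c : 'M[nat]_(m, n) -> K) :=
  [/\ uniq s, forall M, M \in s -> c M != 0, size s = (r.+1)`!, vanishes r s c &
      forall i j, exists2 M, M \in s & M i j = 0%N].

Definition unit_row_structure m n r (s : seq 'M[nat]_(m, n)) (i : 'I_m) d (J : {set 'I_n}) :=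
  [/\ (0 < d)%N, #|J| = r.+1,
      forall M, M \in s -> exists2 j, j \in J & row i M = row_unit d j &
      forall j, j \in J -> exists2 M, M \in s & row i M = row_unit d j].

Lemma size_fibers_ge m n (s : seq 'M[nat]_(m, n)) i k :
  (forall e, e \in row_exps s i -> (k <= size (fiber s i e))%N) ->
  (size (row_exps s i) * k <= size s)%N.
Proof.
move=> H; rewrite (size_fibers s i) -sum1_size big_distrl /=.
by rewrite big_seq [leqRHS]big_seq; apply: leq_sum => e /H; rewrite mul1n.
Qed.

(** A single row exponent is zero, as no variable divides all terms. With two or more, some fiber
    does not vanish in rank [r], since otherwise there would be at least twice [(r+1)!] terms. That
    fiber makes the row monomials dependent, so there are at least [r + 1] of them; each fiber has
    at least [r!] terms, so there are exactly [r + 1]. *)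
Lemma row_structure m n r (s : seq 'M[nat]_(m, n)) c i : (2 <= r)%N -> extremal r s c ->
  (forall M, M \in s -> row i M = const_mx 0%N) \/
  exists d J, unit_row_structure r s i d J.
Proof.
move=> r2 [us cn0 sz van min0]; pose S := row_exps s i.
have uS : uniq S by exact: undup_uniq.
have fib_uniq e : uniq (fiber s i e) by rewrite filter_uniq.
have fib_cn0 e M : M \in fiber s i e -> c M != 0 by rewrite mem_filter => /andP[_ /cn0].
have Smin0 j : exists2 e, e \in S & e 0 j = 0%N.
  have [M Ms Mij] := min0 i j; exists (row i M); last by rewrite mxE.
  by apply/mem_row_exps; exists M.
case: (leqP (size S) 1) => szS.
  left=> M Ms; apply/rowP => j; rewrite mxE; have [e eS <-] := Smin0 j.
  have MS : row i M \in S by apply/mem_row_exps; exists M.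
  by rewrite (count_le1 (a := predT) _ eS MS) ?count_predT ?mxE.
right; case: (classic (exists e A, (\rank A <= r)%N /\ ev (fiber s i e) c A != 0)); last first.
  move=> none; have := leqnn (size s); rewrite leqNgt => /negP[].
  apply: leq_trans (size_fibers_ge (i := i) (k := (r.+1)`!) _).
    by rewrite sz -{1}(mul1n (_)`!) ltn_pmul2r ?fact_gt0.
  move=> e eS; apply: (vanishes_many_terms (c := c)) => //; first exact: fib_cn0.
    by rewrite -fiber_neq0.
  move=> A rA; apply/eqP; apply: contraT => evn0.
  by case: none; exists e, A.
move=> [e [A [rA evn0]]]; have dep := row_exps_dependent van rA evn0.
have szS' : size S = r.+1.
  apply/eqP; rewrite eqn_leq; apply/andP; split.
    rewrite -(leq_pmul2r (fact_gt0 r)) -factS -sz.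
    apply: size_fibers_ge => e' eS; case: r r2 van {sz rA dep} => // r _ van.
    apply: (vanishes_many_terms (c := c)) => //; first exact: fib_cn0.
      by rewrite -fiber_neq0.
    exact: fiber_vanishes_lower.
  have [t t_inj] := ex_inj_ord K n; have [w rel ex] := dep t.
  exact: leq_trans (relation_support t_inj uS rel ex) (count_size _ _).
have [d [J [d0 cJ SJ JS]]] := dependent_rows_structure r2 uS szS' dep Smin0.
exists d, J; split=> // [M Ms|j /JS /mem_row_exps[M Ms ->]]; last by exists M.
by apply: SJ; apply/mem_row_exps; exists M.
Qed.

Lemma mon_tr m n (A : 'M[K]_(m, n)) M : mon A^T M^T = mon A M.
Proof.
rewrite /mon [LHS]exchange_big /=; apply: eq_bigr => i _; apply: eq_bigr => j _.
by rewrite !mxE.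
Qed.

Lemma extremal_tr m n r (s : seq 'M[nat]_(m, n)) c : extremal r s c ->
  extremal r (map trmx s) (c \o trmx).
Proof.
move=> [us cn0 sz van min0]; split.
- by rewrite map_inj_uniq //; exact: trmx_inj.
- by move=> _ /mapP[M Ms ->] /=; rewrite trmxK cn0.
- by rewrite size_map.
- move=> A; rewrite -mxrank_tr => /van evA; rewrite /ev big_map -[RHS]evA.
  by apply: eq_bigr => M _ /=; rewrite trmxK -[in LHS](trmxK A) mon_tr.
- move=> j i; have [M Ms Mij] := min0 i j.
  by exists M^T; rewrite ?map_f // mxE.
Qed.

Section Extremal.
Variables (m n r : nat) (s : seq 'M[nat]_(m, n)) (c : 'M[nat]_(m, n) -> K).
Hypotheses (r_ge2 : (2 <= r)%N) (ext : extremal r s c).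

Lemma row_support1 M (i : 'I_m) (j j' : 'I_n) : M \in s ->
  (0 < M i j)%N -> (0 < M i j')%N -> j = j'.
Proof.
move=> Ms; case: (row_structure i r_ge2 ext) => [/(_ M Ms)/rowP r0|[d [J [_ _ H _]]]].
  by have := r0 j; rewrite !mxE => ->.
have [k _ /rowP rk] := H _ Ms.
have E h : M i h = if h == k then d else 0%N by have := rk h; rewrite !mxE.
by rewrite !E; case: eqP => // -> _; case: eqP.
Qed.

Lemma col_support1 M (i i' : 'I_m) (j : 'I_n) : M \in s ->
  (0 < M i j)%N -> (0 < M i' j)%N -> i = i'.
Proof.
move=> Ms; case: (row_structure j r_ge2 (extremal_tr ext)).
  move=> /(_ M^T (map_f _ Ms))/rowP r0; have := r0 i; rewrite !mxE => ->.
  by [].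
move=> [d [J [_ _ H _]]].
have [k _ /rowP rk] := H _ (map_f _ Ms).
have E h : M h j = if h == k then d else 0%N by have := rk h; rewrite !mxE.
by rewrite !E; case: eqP => // -> _; case: eqP.
Qed.

Section StructuredRow.
Variables (i0 : 'I_m) (d : nat) (J : {set 'I_n}).
Hypothesis iJ : unit_row_structure r s i0 d J.

(** Some term contains the variable at [(i0, l)], which excludes the trivial case of the row
    structure of the transpose. *)
Lemma col_support_ex M (l : 'I_n) : M \in s -> l \in J -> exists a, (0 < M a l)%N.
Proof.
move=> Ms lJ; have [d0 cJ sJ Js] := iJ.
case: (row_structure l r_ge2 (extremal_tr ext)) => [r0|[d' [I [d'0 _ H _]]]].
  have [M1 M1s /rowP/(_ l)] := Js _ lJ; rewrite !mxE eqxx.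
  have /rowP/(_ i0) := r0 M1^T (map_f _ M1s); rewrite !mxE => -> d00.
  by rewrite -d00 in d0.
have [k _ /rowP/(_ k)] := H _ (map_f _ Ms); rewrite !mxE eqxx => E.
by exists k; rewrite E.
Qed.

(** Once [l'] is identified with [l], row [i0] has at most [r] exponents, so its fibers vanish in
    rank [r]. A surviving term would lie in a fiber of at least [(r+1)!] terms, but those come from
    a proper part of [s]. *)
Lemma merge_cancel (l l' : 'I_n) N : l \in J -> l' \in J -> l != l' ->
  \sum_(M <- s | merge_col l l' M == N) c M = 0.
Proof.
move=> lJ l'J ll'; have [us cn0 sz van min0] := ext; have [d0 cJ sJ Js] := iJ.
apply/eqP; apply: contraT => cN; pose s' := merge_supp l l' s c; pose c' := merge_coef l l' s c.
have us' : uniq s' by rewrite filter_uniq ?undup_uniq.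
have Ns' : N \in s'.
  rewrite mem_filter cN mem_undup /=; apply: contraNT cN => Ns.
  rewrite big1_seq // => M /andP[/eqP MN Ms].
  by rewrite -MN map_f in Ns.
have rowE M : M \in s' -> exists2 j, j \in J :\ l' & row i0 M = row_unit d j.
  case/mem_merge_supp=> M1 M1s ->; have [j jJ rj] := sJ _ M1s.
  exists (if j == l' then l else j); last exact: merge_row_unit.
  by have [_|jl'] := eqVneq j l'; rewrite !inE ?ll' ?jl'.
have cJl' : #|J :\ l'| = r by move: cJ; rewrite (cardsD1 l') l'J => -[].
have szr : (size (row_exps s' i0) <= r)%N.
  rewrite -cJl' cardE -(size_map (row_unit d)); apply: uniq_leq_size; first exact: undup_uniq.
  move=> e /mem_row_exps[M /rowE[j jJ ->] ->].
  by apply: map_f; rewrite mem_enum.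
have [j0 j0J rN] := rowE _ Ns'.
have van' := fibers_vanish (merge_vanishes ll' van) szr (row_unit d j0).
have : ((r.+1)`! <= size (fiber s' i0 (row_unit d j0)))%N.
  apply: (vanishes_many_terms _ _ _ van').
  - by rewrite filter_uniq.
  - by move=> M; rewrite !mem_filter => /and3P[].
  - by rewrite -fiber_neq0; apply/mem_row_exps; exists N.
(* As [r] is at least 2, a further column [j1] remains; a term using it in row [i0] does not reach
   the fiber of [j0]. *)
have [j1 /andP[j1j0 j1J]] : exists j1, (j1 != j0) && (j1 \in J :\ l').
  have : (0 < #|(J :\ l') :\ j0|)%N.
    have E := cardsD1 j0 (J :\ l'); rewrite cJl' j0J in E.
    have : (1 < true + #|(J :\ l') :\ j0|)%N by rewrite -E.
    by rewrite add1n ltnS.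
  by case/card_gt0P=> j1; rewrite in_setD1; exists j1.
have [M1 M1s rM1] := Js j1 (subsetP (subsetDl _ _) _ j1J).
have rM1' : row i0 (merge_col l l' M1) != row_unit d j0.
  rewrite (merge_row_unit ll' rM1) (inj_eq (row_unit_inj d0)).
  by move: j1J; rewrite !inE => /andP[/negPf-> _].
rewrite -sz leqNgt => /negP[].
have : (size (fiber s' i0 (row_unit d j0)) <=
    size (map (merge_col l l') [seq M <- s | row i0 (merge_col l l' M) == row_unit d j0]))%N.
  apply: uniq_leq_size; first by rewrite filter_uniq.
  move=> M; rewrite mem_filter => /andP[/eqP rM /mem_merge_supp[M2 M2s M2E]].
  by rewrite M2E; apply: map_f; rewrite mem_filter M2s -M2E rM eqxx.
move/leq_ltn_trans; apply; rewrite size_map size_filter ltn_neqAle count_size andbT -all_count.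
by apply/allPn; exists M1.
Qed.

(** A term has at most one variable in each row and exactly one in each of the columns [l] and [l'].
    The merged column thus has two nonzero entries, and only their distribution to [l] and [l'] is
    lost. *)
Lemma merge_col_eq (l l' : 'I_n) M M' : l \in J -> l' \in J -> l != l' ->
  M \in s -> M' \in s -> merge_col l l' M' = merge_col l l' M ->
  M' = M \/ M' = xcol l l' M.
Proof.
move=> lJ l'J ll' Ms M's /matrixP mE.
have off k j : j != l -> j != l' -> M' k j = M k j.
  by move=> jl jl'; have := mE k j; rewrite !mxE (negPf jl) (negPf jl').
have sum k : (M' k l + M' k l' = M k l + M k l')%N.
  by have := mE k l; rewrite !mxE (negPf ll') eqxx.
have Z M1 k j : ~~ (0 < M1 k j)%N -> M1 k j = 0%N :> nat by rewrite lt0n negbK => /eqP.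
have row0 M1 k : M1 \in s -> (0 < M1 k l)%N -> M1 k l' = 0%N.
  move=> M1s pos; apply: Z; apply: contraNN ll' => pos'.
  by apply/eqP; exact: row_support1 pos pos'.
have col0 M1 a k j : M1 \in s -> (0 < M1 a j)%N -> k != a -> M1 k j = 0%N.
  move=> M1s pos ka; apply: Z; apply: contraNN ka => pos'.
  by apply/eqP; exact: col_support1 pos' pos.
have [a al] := col_support_ex Ms lJ; have [a' a'l] := col_support_ex M's lJ.
have [aa'|aa'] := eqVneq a' a.
  left; subst a'; apply/matrixP => k j.
  have El : M' k l = M k l.
    have [->|ka] := eqVneq k a; last first.
      by rewrite (col0 M' a k l) // (col0 M a k l).
    by have := sum a; rewrite (row0 M' a) // (row0 M a) // !addn0.
  have [->//|jl] := eqVneq j l.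
  have [->|jl'] := eqVneq j l'; last exact: off.
  by apply/eqP; rewrite -(eqn_add2l (M' k l)) sum El.
right.
have M'a : M' a l = 0%N by apply: (col0 _ a') => //; rewrite eq_sym.
have M'al' : M' a l' = M a l by have := sum a; rewrite M'a (row0 M a) // addn0.
have Ma' : M a' l = 0%N by apply: (col0 _ a).
have Ma'l' : M a' l' = M' a' l by have := sum a'; rewrite Ma' (row0 M' a') // addn0.
have [pos pos'] : (0 < M' a l')%N /\ (0 < M a' l')%N by rewrite M'al' Ma'l'.
have swap k : M' k l = M k l' /\ M' k l' = M k l.
  have [->|ka] := eqVneq k a; first by rewrite M'a (row0 M a).
  have [->|ka'] := eqVneq k a'; first by rewrite (row0 M' a') // Ma'.
  rewrite (col0 M' a' k l) // (col0 M a' k l') // (col0 M' a k l') //.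
  by rewrite (col0 M a k l).
apply/matrixP => k j; rewrite mxE.
have [->|jl] := eqVneq j l; first by rewrite tpermL; have [] := swap k.
have [->|jl'] := eqVneq j l'; first by rewrite tpermR; have [] := swap k.
by rewrite tpermD 1?eq_sym // off.
Qed.

(** Only [M] and its column swap can have the same merge as [M]. Their coefficients sum to zero and
    that of [M] is nonzero, so the swap must occur. *)
Lemma xcol_coef (l l' : 'I_n) M : l \in J -> l' \in J -> l != l' -> M \in s ->
  xcol l l' M \in s /\ c (xcol l l' M) = - c M.
Proof.
move=> lJ l'J ll' Ms; have [us cn0 _ _ _] := ext.
have := merge_cancel (merge_col l l' M) lJ l'J ll'.
have mx : merge_col l l' (xcol l l' M) = merge_col l l' M.
  apply/matrixP => i j; rewrite !mxE tpermL tpermR.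
  have [//|jl'] := eqVneq j l'; have [_|jl] := eqVneq j l; first by rewrite addnC.
  by rewrite tpermD 1?eq_sym.
have xM : xcol l l' M != M.
  have [a al] := col_support_ex Ms lJ.
  apply/eqP => /matrixP/(_ a l'); rewrite mxE tpermR => E.
  by move: ll'; rewrite (row_support1 Ms al (_ : 0 < M a l')%N) ?eqxx // -E.
rewrite -big_filter; set f := [seq _ <- s | _].
have fE : f =i [seq M' <- [:: M; xcol l l' M] | M' \in s].
  move=> M'; rewrite !mem_filter !inE.
  have [M's|] := boolP (M' \in s); rewrite ?andbT ?andbF //=.
  apply/eqP/orP => [/(merge_col_eq lJ l'J ll' Ms M's)[]->|[]/eqP->] //; rewrite ?eqxx.
    by left.
  by right.
have pf : perm_eq f [seq M' <- [:: M; xcol l l' M] | M' \in s].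
  by apply: uniq_perm => //; rewrite filter_uniq //= inE eq_sym xM.
rewrite (perm_big _ pf) /= Ms; case: ifP => xs.
  by rewrite big_cons big_seq1 => /eqP; rewrite addrC addr_eq0 => /eqP.
by rewrite big_seq1 => /eqP; rewrite (negPf (cn0 _ Ms)).
Qed.

End StructuredRow.
End Extremal.
End ShortSums.

(** * Terms indexed by permutations *)

Section PermutationTerms.
Variable K : closedFieldType.

(** Exponent matrix of the product over [a] of the variables at [(rs a, cs (pi a))] to the power
    [D a]. *)
Definition perm_exp m n k (rs : 'I_k -> 'I_m) (cs : 'I_k -> 'I_n) (D : 'I_k -> nat)
    (pi : 'S_k) : 'M[nat]_(m, n) :=
  \matrix_(i, j) (\sum_a (if (i == rs a) && (j == cs (pi a)) then D a else 0))%N.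

Lemma perm_expE m n k (rs : 'I_k -> 'I_m) (cs : 'I_k -> 'I_n) D pi a j :
  injective rs -> perm_exp rs cs D pi (rs a) j = if j == cs (pi a) then D a else 0%N.
Proof.
move=> rs_inj; rewrite mxE (bigD1 a) //= eqxx big1 ?addn0 // => b ba.
by rewrite (inj_eq rs_inj) eq_sym (negPf ba).
Qed.

Lemma mon_perm_exp (R : comNzRingType) m n k (rs : 'I_k -> 'I_m) (cs : 'I_k -> 'I_n)
    D pi (A : 'M[R]_(m, n)) :
  mon A (perm_exp rs cs D pi) = \prod_a A (rs a) (cs (pi a)) ^+ D a.
Proof.
transitivity (\prod_i \prod_j \prod_a
    A i j ^+ (if (i == rs a) && (j == cs (pi a)) then D a else 0%N)).
  by apply: eq_bigr => i _; apply: eq_bigr => j _; rewrite mxE expr_sum.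
under eq_bigr => i _ do rewrite exchange_big.
rewrite exchange_big /=; apply: eq_bigr => a _.
rewrite (bigD1 (rs a)) //= [X in _ * X]big1 ?mulr1 => [|i ia]; last first.
  by apply: big1 => j _; rewrite (negPf ia) expr0.
rewrite (bigD1 (cs (pi a))) //= !eqxx big1 ?mulr1 // => j ja.
by rewrite (negPf ja) andbF expr0.
Qed.

(** One term [M0] fixes the data: [cs] lists the columns in [J], [rs a] is the row where [M0] meets
    column [cs a], and [D a] is the exponent there. Column swaps within [J] reach [(r+1)!] distinct
    terms with signed coefficients, hence all of [s]. *)
Lemma extremal_perms m n r (s : seq 'M[nat]_(m, n)) (c : 'M[nat]_(m, n) -> K) :
  (2 <= r)%N -> extremal r s c ->
  exists (rs : 'I_r.+1 -> 'I_m) (cs : 'I_r.+1 -> 'I_n) (D : 'I_r.+1 -> nat) c0,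
  [/\ injective rs, injective cs, forall a, (0 < D a)%N & c0 != 0] /\
  [/\ injective (perm_exp rs cs D),
      perm_eq s [seq perm_exp rs cs D pi | pi <- enum 'S_r.+1] &
      forall pi, c (perm_exp rs cs D pi) = (-1) ^+ (odd_perm pi) * c0].
Proof.
move=> r2 ext; have [us cn0 sz van min0] := ext.
have [M0 M0s] : exists M, M \in s.
  case: (s) sz => [|M s' _]; last by exists M; rewrite mem_head.
  by move/eqP; rewrite eq_sym -leqn0 leqNgt fact_gt0.
have [i0 [d [J iJ]]] : exists i0 d J, unit_row_structure r s i0 d J.
  apply: NNPP => none.
  have s0 M : M \in s -> M = const_mx 0%N.
    move=> Ms; apply/row_matrixP => i; rewrite row_const.
    case: (row_structure i r2 ext) => [/(_ M Ms)//|[d [J iJ]]].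
    by case: none; exists i, d, J.
  have : (size s <= 1)%N.
    by apply: (uniq_leq_size (s2 := [:: const_mx 0%N]) us) => M /s0->; rewrite inE.
  by rewrite sz leqNgt (leq_trans r2) // (leq_trans (leqnSn r)) // fact_geq.
have [d0 cJ _ _] := iJ.
pose cs (a : 'I_r.+1) : 'I_n := enum_val (cast_ord (esym cJ) a).
have cs_inj : injective cs by move=> a b /enum_val_inj /cast_ord_inj.
have csJ a : cs a \in J by exact: enum_valP.
have csP j : j \in J -> exists a, j = cs a.
  move=> jJ; exists (cast_ord cJ (enum_rank_in jJ j)).
  by rewrite /cs cast_ordK enum_rankK_in.
have [rs rsP] : exists rs : 'I_r.+1 -> 'I_m, forall a, (0 < M0 (rs a) (cs a))%N.
  apply: (fin_all_exists (P := fun a i => (0 < M0 i (cs a))%N)) => a.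
  exact: (col_support_ex r2 ext iJ M0s (csJ a)).
have rs_inj : injective rs.
  move=> a b ab; apply: cs_inj; apply: (row_support1 r2 ext M0s (rsP a)).
  by rewrite ab.
pose D a := M0 (rs a) (cs a).
pose U : 'M[nat]_(m, n) := \matrix_(i, j) (if j \in J then 0%N else M0 i j).
pose N pi : 'M[nat]_(m, n) := \matrix_(i, j) (U i j + perm_exp rs cs D pi i j)%N.
have N1 : N 1%g = M0.
  apply/matrixP => i j; rewrite !mxE; case: ifP => jJ; last first.
    rewrite big1 ?addn0 // => a _; rewrite perm1; case: andP => // -[_ /eqP jE].
    by rewrite jE csJ in jJ.
  have [b ->] := csP _ jJ; rewrite (bigD1 b) //= big1 ?addn0 => [|a ab]; last first.
    by rewrite perm1 (inj_eq cs_inj) (eq_sym b) (negPf ab) andbF.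
  rewrite perm1 eqxx andbT; case: eqP => [->//|/eqP ib].
  apply/eqP; rewrite eq_sym -leqn0 leqNgt; apply: contraNN ib => pos.
  by apply/eqP; exact: (col_support1 r2 ext M0s pos (rsP b)).
have Ntperm pi a b : N (pi * tperm a b)%g = xcol (cs a) (cs b) (N pi).
  apply/matrixP => i j; rewrite !mxE; congr (_ + _)%N.
    case: tpermP => [->|->|//]; by rewrite !csJ.
  apply: eq_bigr => z _; rewrite permM.
  suff -> : (j == cs (tperm a b (pi z))) = (tperm (cs a) (cs b) j == cs (pi z)) by [].
  rewrite -[in RHS](inj_eq (@perm_inj _ (tperm (cs a) (cs b)))) tpermK.
  by rewrite (inj_tperm _ _ _ cs_inj).
have Ns pi : N pi \in s /\ c (N pi) = (-1) ^+ (odd_perm pi) * c M0.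
  have [ts -> tsd] := prod_tpermP pi.
  elim/last_ind: ts tsd => [|ts [a b] IH].
    by rewrite big_nil N1 odd_perm1 expr0 mul1r.
  rewrite all_rcons => /andP[/= ab /IH[IHs IHc]].
  have cab : cs a != cs b by rewrite (inj_eq cs_inj).
  rewrite big_rcons /= Ntperm; have [xs xc] := xcol_coef r2 ext iJ (csJ a) (csJ b) cab IHs.
  split=> //; rewrite xc IHc odd_permM odd_tperm.
  by move: ab; rewrite /dpair /= => ->; rewrite addbT signrN mulNr.
have Nval pi a j : j \in J -> N pi (rs a) j = if j == cs (pi a) then D a else 0%N.
  by move=> jJ; rewrite mxE mxE jJ add0n perm_expE.
have N_inj : injective N.
  move=> p q /matrixP pq; apply/permP => a; apply: cs_inj; apply/eqP; apply: contraT => ne.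
  have := pq (rs a) (cs (p a)); rewrite !Nval // eqxx (negPf ne) => Da.
  by have := rsP a; rewrite -/(D a) Da.
have pN : perm_eq s [seq N pi | pi <- enum 'S_r.+1].
  rewrite perm_sym; have uN : uniq [seq N pi | pi <- enum 'S_r.+1].
    by rewrite map_inj_uniq ?enum_uniq.
  apply: uniq_perm => //.
  have sub : {subset [seq N pi | pi <- enum 'S_r.+1] <= s}.
    by move=> _ /mapP[pi _ ->]; have [] := Ns pi.
  have [|_] := uniq_min_size uN sub; first by rewrite sz size_map -cardE card_Sn.
  by [].
(* The part [U] of [M0] outside [J] is untouched by the swaps and divides every term, so it is
   trivial. *)
have U0 i j : U i j = 0%N.
  have [M] := min0 i j; rewrite (perm_mem pN) => /mapP[pi _ ->].
  by rewrite mxE => /eqP; rewrite addn_eq0 => /andP[/eqP].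
have NE : N =1 perm_exp rs cs D.
  by move=> pi; apply/matrixP => i j; rewrite mxE U0.
exists rs, cs, D, (c M0); split; split=> //; first exact: cn0.
- by move=> p q; rewrite -!NE => /N_inj.
- by rewrite -(eq_map NE).
- by move=> pi; rewrite -NE; have [] := Ns pi.
Qed.

Lemma ev_perms m n k (s : seq 'M[nat]_(m, n)) (c : 'M[nat]_(m, n) -> K)
    (rs : 'I_k -> 'I_m) (cs : 'I_k -> 'I_n) D c0 A :
  perm_eq s [seq perm_exp rs cs D pi | pi <- enum 'S_k] ->
  (forall pi, c (perm_exp rs cs D pi) = (-1) ^+ (odd_perm pi) * c0) ->
  ev s c A = c0 * \det (\matrix_(a, b) A (rs a) (cs b) ^+ D a).
Proof.
move=> ps cE; rewrite /ev (perm_big _ ps) big_map big_enum /= mulr_sumr.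
apply: eq_bigr => pi _; rewrite cE mon_perm_exp mulrA (mulrC c0); congr (_ * _).
by apply: eq_bigr => a _; rewrite mxE.
Qed.

End PermutationTerms.

(** * Determinants of entrywise powers *)

Section PowerDeterminant.
Variable K : closedFieldType.

(** The derivatives at 0 of [(X + 1)^k] and [X^k + 1] are [k] and, for [k] at least 2, zero. *)
Lemma additive_pow_char k : (0 < k)%N ->
  (forall y : K, (y + 1) ^+ k = y ^+ k + 1) -> k = 1%N \/ k%:R = 0 :> K.
Proof.
case: k => // -[|k] _ H; [by left | right].
have E : ('X + 1) ^+ k.+2 = 'X ^+ k.+2 + 1 :> {poly K}.
  apply/eqP; rewrite -subr_eq0; apply/eqP/poly_fun_eq0 => y.
  by rewrite !hornerE H subrr.
have := congr1 (fun p => p^`().[0]) E.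
rewrite -polyC1 derivD !deriv_exp derivD derivX derivC !addr0 !mul1r !hornerMn !horner_exp.
by rewrite !hornerE expr1n expr0n mul0rn.
Qed.

(** In positive characteristic write [d = k * p^e] with [k] prime to [p]. Every [y] is a [p^e]-th
    power, so Frobenius turns additivity for [d] into [(y + 1)^k = y^k + 1], which forces
    [k = 1]. *)
Lemma additive_pow_exponent d p : (0 < d)%N -> char_exponent K p ->
  (forall x y : K, (x + y) ^+ d = x ^+ d + y ^+ d) -> exists e, d = (p ^ e)%N.
Proof.
move=> d0 chp H; have H1 y : (y + 1) ^+ d = y ^+ d + 1 :> K by rewrite H expr1n.
case: chp => [[-> /pcharf0P ch0]|chp].
  exists 0%N; case: (additive_pow_char d0 H1) => // /eqP.
  by rewrite ch0 => /eqP dz; rewrite dz in d0.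
have pp : prime p by exact: pcharf_prime chp.
have [k cop dE] := pfactor_coprime pp d0; set e := logn p d in dE.
exists e; rewrite {1}dE.
have k0 : (0 < k)%N by move: d0; rewrite dE muln_gt0 => /andP[].
have pe0 : (0 < p ^ e)%N by rewrite expn_gt0 prime_gt0.
suff Hk (y : K) : (y + 1) ^+ k = y ^+ k + 1.
  case: (additive_pow_char k0 Hk) => [->|/eqP]; first by rewrite mul1n.
  by rewrite -(dvdn_pcharf chp) => pk; move: cop; rewrite prime_coprime // pk.
have : size ('X^(p ^ e) - y%:P) != 1 by rewrite size_XnsubC // eqSS -lt0n.
case/closed_rootP => x; rewrite /root !hornerE subr_eq0 => /eqP <-.
rewrite -[X in _ + X](expr1n _ (p ^ e)) -exprDn_pchar; last first.
  by rewrite pnatX (pnatE _ pp) chp.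
by rewrite -!exprM mulnC -[(k * _)%N]dE.
Qed.

Lemma rank_lt_row_kernel n (W : 'M[K]_n.+1) (u : 'rV_n.+1) : u != 0 -> u *m W = 0 ->
  (\rank W <= n)%N.
Proof.
move=> u0 uW; rewrite leqNgt; apply/negP => rW.
have : row_free W by rewrite /row_free eqn_leq rank_leq_row.
by move=> fW; have := mulmx_free_eq0 u fW; rewrite uW eqxx (negPf u0).
Qed.

Variables (r : nat) (D : 'I_r.+1 -> nat).
Hypotheses (r_ge2 : (2 <= r)%N) (D_gt0 : forall a, (0 < D a)%N).
Hypothesis det0 : forall W : 'M[K]_r.+1, (\rank W <= r)%N ->
  \det (\matrix_(a, b) W a b ^+ D a) = 0.

Lemma natr_bool_pow (b : bool) k : (0 < k)%N -> (b%:R ^+ k = b%:R :> K).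
Proof. by case: k b => // k []; rewrite ?expr1n // expr0n. Qed.

Lemma det_pow_additive a (x y : K) : (x + y) ^+ D a = x ^+ D a + y ^+ D a.
Proof.
have [b1 [b2 [b1a b2a b12]]] : exists b1 b2, [/\ b1 != a, b2 != a & b1 != b2].
  have : (1 < #|[set~ a]|)%N by rewrite cardsC1 card_ord.
  by case/card_gt1P => b1 [b2 []]; rewrite !inE => ? ? ?; exists b1, b2.
(* Column [a] is the sum of columns [b1] and [b2], so [W] is singular. The other rows have entries 0
   and 1, so powers change only row [a], and a kernel vector yields the identity. *)
pose W : 'M[K]_r.+1 := \matrix_(k, l)
  (if k == a then (if l == a then x + y else if l == b1 then x else if l == b2 then y else 0)
   else ((k == l) || ((l == a) && ((k == b1) || (k == b2))))%:R).
have rW : (\rank W <= r)%N.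
  pose u : 'rV[K]_r.+1 := delta_mx 0 a - delta_mx 0 b1 - delta_mx 0 b2.
  rewrite -mxrank_tr; apply: (@rank_lt_row_kernel _ _ u).
    apply/eqP => /rowP/(_ a); rewrite !mxE !eqxx /= eq_sym (negPf b1a) eq_sym (negPf b2a) !subr0.
    by move/eqP; rewrite oner_eq0.
  rewrite !mulmxBl -!rowE; apply/rowP => k; rewrite !mxE !eqxx (negPf b1a) (negPf b2a).
  rewrite (eq_sym b2) (negPf b12) /= !orbF.
  have [_|ka] := eqVneq k a; first by rewrite -addrA -opprD subrr.
  have [->|] := eqVneq k b1; first by rewrite (negPf b12) /= subrr subr0.
  by have [->|] := eqVneq k b2; rewrite /= subr0 subrr.
have /eqP/det0P[v v0 vW] := det0 rW.
have vWl l : v 0 a * W a l ^+ D a + \sum_(k | k != a) v 0 k * W k l = 0.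
  have /rowP/(_ l) := vW; rewrite !mxE (bigD1 a) //= mxE => E.
  rewrite -[RHS]E; congr (_ + _); first by rewrite [W a l]mxE.
  apply: eq_bigr => k ka.
  by rewrite !mxE (negPf ka) natr_bool_pow.
have vl l : l != a -> v 0 l = - (v 0 a * W a l ^+ D a).
  move=> la; apply/eqP; rewrite -addr_eq0 addrC -[X in _ == X](vWl l) (bigD1 l) //=.
  rewrite [W l l]mxE (negPf la) eqxx mulr1 big1 ?addr0 // => k /andP[ka kl].
  by rewrite mxE (negPf ka) (negPf kl) (negPf la) mulr0.
have va : v 0 a != 0.
  apply: contraNneq v0 => va0; apply/eqP/rowP => l; rewrite mxE.
  by have [->//|/vl->] := eqVneq l a; rewrite va0 mul0r oppr0.
have := vWl a; rewrite (bigD1 b1) //= (bigD1 b2) /= ?b2a 1?eq_sym //.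
rewrite big1 => [|k /andP[/andP[ka kb1] kb2]]; last first.
  by rewrite mxE (negPf ka) (negPf kb1) (negPf kb2) andbF mulr0.
rewrite (vl b1) // (vl b2) // !mxE !eqxx (negPf b1a) (negPf b2a) (eq_sym b2) (negPf b12).
rewrite !orbT !mulr1 addr0.
rewrite -opprD -mulrDr -mulrBr => /eqP; rewrite mulf_eq0 (negPf va) /= subr_eq0.
by move/eqP.
Qed.

Lemma det_pow_exponents_eq a b : D a = D b.
Proof.
have [->//|ab] := eqVneq a b.
suff E (t : K) : t ^+ D a = t ^+ D b.
  have /(congr1 (fun p : {poly K} => size p)) : 'X^(D a) = 'X^(D b) :> {poly K}.
    apply/eqP; rewrite -subr_eq0; apply/eqP/poly_fun_eq0 => t.
    by rewrite !hornerE E subrr.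
  by rewrite !size_polyXn => -[].
(* Rows [a] and [b] coincide, with entries [1] and [t] in columns [a] and [b]; after taking powers,
   singularity forces [t ^+ D a = t ^+ D b]. *)
pose W : 'M[K]_r.+1 := \matrix_(k, l)
  (if (k == a) || (k == b) then (if l == a then 1 else if l == b then t else 0)
   else (k == l)%:R).
have rW : (\rank W <= r)%N.
  pose u : 'rV[K]_r.+1 := delta_mx 0 a - delta_mx 0 b.
  apply: (@rank_lt_row_kernel _ _ u).
    apply/eqP => /rowP/(_ a); rewrite !mxE !eqxx /= (negPf ab) subr0.
    by move/eqP; rewrite oner_eq0.
  by rewrite mulmxBl -!rowE; apply/rowP => k; rewrite !mxE !eqxx orbT subrr.
have /eqP/det0P[v v0 vW] := det0 rW.
have ba : b != a by rewrite eq_sym.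
have vWl l : v 0 a * W a l ^+ D a + v 0 b * W b l ^+ D b
    + \sum_(k | (k != a) && (k != b)) v 0 k * (k == l)%:R = 0.
  have /rowP/(_ l) := vW; rewrite !mxE (bigD1 a) //= (bigD1 b) //= !mxE addrA => E.
  rewrite -[RHS]E; congr (_ + _); apply: eq_bigr => k /andP[ka kb].
  by rewrite !mxE (negPf ka) (negPf kb) natr_bool_pow.
have sum0 l : (l == a) || (l == b) ->
    \sum_(k | (k != a) && (k != b)) v 0 k * (k == l)%:R = 0.
  move=> lab; rewrite big1 // => k /andP[ka kb].
  by case/orP: lab => /eqP->; rewrite ?(negPf ka) ?(negPf kb) mulr0.
have := vWl a; rewrite sum0 ?eqxx // !mxE !eqxx orbT !expr1n !mulr1 addr0 => /eqP.
rewrite addrC addr_eq0 => /eqP vb.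
have := vWl b; rewrite sum0 ?eqxx ?orbT // !mxE !eqxx orbT (eq_sym b) (negPf ab) addr0.
rewrite vb mulNr -mulrBr => /eqP; rewrite mulf_eq0 => /orP[/eqP va|]; last first.
  by rewrite subr_eq0 => /eqP.
case/negP: v0; apply/eqP/rowP => l; rewrite mxE.
have [->//|la] := eqVneq l a; have [->|lb] := eqVneq l b; first by rewrite vb va oppr0.
have := vWl l; rewrite vb va oppr0 !mul0r !add0r (bigD1 l) ?la //= eqxx mulr1.
by rewrite big1 ?addr0 // => k /andP[_ /negPf->]; rewrite mulr0.
Qed.

End PowerDeterminant.

(** * Passage from rank exactly [r] to rank at most [r], and removal of the common monomial *)

Section Genericity.
Variable K : closedFieldType.
Implicit Types m n r : nat.

Lemma polyfun_ev m n (s : seq 'M[nat]_(m, n)) (c : 'M[nat]_(m, n) -> K) (P : K -> 'M[K]_(m, n)) :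
  (forall i j, polyfun (fun x => P x i j)) -> polyfun (fun x => ev s c (P x)).
Proof.
move=> HP; apply: polyfun_sum => M; apply: polyfunM; first exact: polyfunC.
by apply: polyfun_prod => i; apply: polyfun_prod => j; apply: polyfunXn.
Qed.

(* The matrices of rank at most r form an irreducible variety: any two of them
   are joined by a polynomial curve x |-> P x *m Q x, so that g can be cancelled. *)
Lemma vanishes_cancel m n r (s : seq 'M[nat]_(m, n)) c (g : 'M[K]_(m, n) -> K) A1 :
  (forall P : K -> 'M[K]_(m, n), (forall i j, polyfun (fun x => P x i j)) ->
     polyfun (fun x => g (P x))) ->
  (\rank A1 <= r)%N -> g A1 != 0 ->
  (forall A, (\rank A <= r)%N -> g A != 0 -> ev s c A = 0) -> vanishes r s c.
Proof.
move=> gP rA1 gA1 H A rA.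
have [P0 [Q0 ->]] := mxrank_factor rA; have [P1 [Q1 E1]] := mxrank_factor rA1.
pose P x := P0 + x *: (P1 - P0); pose Q x := Q0 + x *: (Q1 - Q0).
have PQ i j : polyfun (fun x => (P x *m Q x) i j).
  by apply: polyfun_mulmx => k l; exact: polyfun_line.
have -> : P0 *m Q0 = P 0 *m Q 0 by rewrite /P /Q !scale0r !addr0.
apply: (@polyfun_eq0 K (fun x => ev s c (P x *m Q x)) (fun x => g (P x *m Q x)) 1).
- exact: polyfun_ev.
- exact: gP.
- by rewrite /P /Q !scale1r ![_ + (_ - _)]addrC !subrK -E1.
- by move=> x; apply: H; exact: mulmx_max_rank.
Qed.

(** Take for [g] the leading [r] by [r] minor: it is nonzero at [pid_mx r], and where it is nonzero
    a rank at most [r] is exactly [r]. *)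
Lemma vanishes_of_rank_eq m n r (s : seq 'M[nat]_(m, n)) (c : 'M[nat]_(m, n) -> K) :
  (r <= m)%N -> (r <= n)%N -> (forall A : 'M[K]_(m, n), \rank A = r -> ev s c A = 0) ->
  vanishes r s c.
Proof.
move=> rm rn H.
apply: (vanishes_cancel (A1 := pid_mx r)
  (g := fun A => \det ((pid_mx r : 'M_(r, m)) *m A *m (pid_mx r : 'M_(n, r))))).
- move=> P HP; apply: polyfun_det => i j; apply: polyfun_mulmx => [k l|k l]; last exact: polyfunC.
  by apply: polyfun_mulmx => // k' l'; exact: polyfunC.
- by rewrite rank_pid_mx.
  rewrite mul_pid_mx minnn (minn_idPr rm) mul_pid_mx minnn (minn_idPr rn) pid_mx_1 det1.
  exact: oner_neq0.
- move=> A rA dA; apply: H; apply/eqP; rewrite eqn_leq rA /=.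
  have : (pid_mx r : 'M_(r, m)) *m A *m (pid_mx r : 'M_(n, r)) \in unitmx.
    by rewrite unitmxE unitfE.
  move/mxrank_unit => {1}<-.
  by apply: leq_trans (mxrankM_maxl _ _) (mxrankM_maxr _ _).
Qed.

Definition addm m n (M N : 'M[nat]_(m, n)) : 'M[nat]_(m, n) := \matrix_(i, j) (M i j + N i j)%N.
Definition subm m n (M N : 'M[nat]_(m, n)) : 'M[nat]_(m, n) := \matrix_(i, j) (M i j - N i j)%N.

Lemma mon_addm (R : comNzRingType) m n (A : 'M[R]_(m, n)) M N :
  mon A (addm M N) = mon A M * mon A N.
Proof.
rewrite /mon -big_split; apply: eq_bigr => i _; rewrite -big_split; apply: eq_bigr => j _.
by rewrite mxE exprD.
Qed.

(** [U] is the entrywise minimum of the exponents. Its monomial can be cancelled because it is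
    nonzero at the all-ones matrix, whose rank is at most 1. *)
Lemma extremal_strip m n r (s : seq 'M[nat]_(m, n)) (c : 'M[nat]_(m, n) -> K) :
  (0 < r)%N -> uniq s -> (forall M, M \in s -> c M != 0) -> size s = (r.+1)`! ->
  vanishes r s c ->
  exists U, {in s, forall M, addm (subm M U) U = M} /\
    extremal r (map (fun M => subm M U) s) (fun N => c (addm N U)).
Proof.
move=> r0 us cn0 sz van.
have [M0 M0s] : exists M, M \in s.
  case: (s) sz => [|M s' _]; last by exists M; rewrite mem_head.
  by move/eqP; rewrite eq_sym -leqn0 leqNgt fact_gt0.
have [u uP] : exists u : 'I_m * 'I_n -> nat, forall p,
    (forall M, M \in s -> (u p <= M p.1 p.2)%N) /\ exists2 M, M \in s & M p.1 p.2 = u p.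
  apply: (fin_all_exists (P := fun (p : 'I_m * 'I_n) v =>
    (forall M, M \in s -> (v <= M p.1 p.2)%N) /\ exists2 M, M \in s & M p.1 p.2 = v)) => p.
  have [M Ms Mmin] := ex_min_seq (fun M : 'M[nat]_(m, n) => M p.1 p.2) M0s.
  by exists (M p.1 p.2); split=> //; exists M.
pose U : 'M[nat]_(m, n) := \matrix_(i, j) u (i, j); exists U.
have subK : {in s, forall M, addm (subm M U) U = M}.
  move=> M Ms; apply/matrixP => i j; rewrite !mxE subnK //.
  by have [/(_ M Ms)] := uP (i, j).
split=> //; split.
- by rewrite map_inj_in_uniq // => M N Ms Ns E; rewrite -(subK _ Ms) E subK.
- by move=> _ /mapP[M Ms ->]; rewrite subK ?cn0.
- by rewrite size_map.
- apply: (vanishes_cancel (A1 := const_mx 1) (g := fun A => mon A U)).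
  + by move=> P HP; apply: polyfun_prod => i; apply: polyfun_prod => j; apply: polyfunXn.
  + by case: r r0 {sz van} => // r _; exact: rank_const1.
  + by rewrite mon_const1 oner_neq0.
  + move=> A rA AU; apply: (mulfI AU); rewrite mulr0 -[RHS](van A rA) /ev big_map mulr_sumr.
    apply: eq_big_seq => M Ms; rewrite mulrCA subK //; congr (_ * _).
    by rewrite mulrC -mon_addm subK.
- move=> i j; have [_ [M Ms E]] := uP (i, j).
  exists (subm M U); first exact: (map_f (fun M => subm M U)).
  by rewrite !mxE E subnn.
Qed.

End Genericity.

(** * Translation between multivariate polynomials and exponent matrices *)

Section PolynomialTranslation.
Variables (K : closedFieldType) (m n : nat).
Implicit Types (f : {mpoly K[m * n]}) (M : 'M[nat]_(m, n)).

Definition mnm_mx (u : 'X_{1..m * n}) : 'M[nat]_(m, n) := \matrix_(i, j) u (mxvec_index i j).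
Definition mx_mnm M : 'X_{1..m * n} := [multinom mxvec M 0%R k | k < m * n].

Lemma mx_mnmK : cancel mx_mnm mnm_mx.
Proof. by move=> M; apply/matrixP => i j; rewrite mxE mnmE mxvecE. Qed.

Lemma mnm_mxK : cancel mnm_mx mx_mnm.
Proof.
move=> u; apply/mnmP => k; rewrite mnmE.
by case/mxvec_indexP: k => i j; rewrite mxvecE mxE.
Qed.

Lemma prod_mxvec (R : comNzRingType) (A : 'M[R]_(m, n)) (u : 'X_{1..m * n}) :
  \prod_k mxvec A 0 k ^+ u k = mon A (mnm_mx u).
Proof.
rewrite /mon pair_bigA (reindex _ (curry_mxvec_bij _ _)) /=.
by apply: eq_bigr => -[i j] _; rewrite /= mxvecE mxE.
Qed.

Definition exp_seq f := map mnm_mx (msupp f).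
Definition exp_coef f M := f@_(mx_mnm M).

Lemma meval_mxpt f (A : 'M[K]_(m, n)) : f.@[mxpt A] = ev (exp_seq f) (exp_coef f) A.
Proof.
rewrite mevalE /ev /exp_seq [RHS]big_map; apply: eq_bigr => u _.
by rewrite /exp_coef mnm_mxK -prod_mxvec.
Qed.

Lemma exp_seq_uniq f : uniq (exp_seq f).
Proof. by rewrite map_inj_uniq ?msupp_uniq //; exact: can_inj mnm_mxK. Qed.

Lemma exp_coef_neq0 f M : M \in exp_seq f -> exp_coef f M != 0.
Proof. by case/mapP => u uf ->; rewrite /exp_coef mnm_mxK -mcoeff_msupp. Qed.

Lemma mpolyX_mon M : 'X_[mx_mnm M] = mon (\matrix_(i, j) xvar K i j) M :> {mpoly K[m * n]}.
Proof.
rewrite -[in RHS](mx_mnmK M) -prod_mxvec mpolyXE_id; apply: eq_bigr => k _.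
by case/mxvec_indexP: k => i j; rewrite mxvecE mxE.
Qed.

Lemma vanishes_exp f r : (r <= m)%N -> (r <= n)%N -> vanishes_on_rank r f ->
  vanishes r (exp_seq f) (exp_coef f).
Proof. by move=> rm rn van; apply: vanishes_of_rank_eq => // A /van; rewrite meval_mxpt. Qed.

End PolynomialTranslation.

(** * Frobenius on determinants and the final assembly *)

Lemma det_pow_pchar (R : comNzRingType) p e k (A : 'M[R]_k) :
  p = 1%N \/ p \in [pchar R] ->
  \det A ^+ (p ^ e) = \det (\matrix_(a, b) A a b ^+ (p ^ e)).
Proof.
case=> [->|chR].
  by rewrite exp1n expr1; congr (\det _); apply/matrixP => a b; rewrite mxE expr1.
elim: e A => [|e IH] A.
  by rewrite expr1; congr (\det _); apply/matrixP => a b; rewrite mxE expr1.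
rewrite expnS exprM -(pFrobenius_autE chR) -det_map_mx IH; congr (\det _).
by apply/matrixP => a b; rewrite !mxE exprM.
Qed.

Theorem theorem3p1 (K : closedFieldType) (p : nat) (m n r : nat) :
  char_exponent K p -> (r <= m)%N -> (r <= n)%N ->
  (forall f : {mpoly K[m * n]},
      f != 0 -> vanishes_on_rank r f -> ((r.+1)`! <= nterms f)%N) /\
  ((2 <= r)%N ->
   forall f : {mpoly K[m * n]},
     nterms f = (r.+1)`! -> vanishes_on_rank r f ->
     exists (c : K) (u : 'X_{1..m * n})
            (rs : 'I_r.+1 -> 'I_m) (cs : 'I_r.+1 -> 'I_n) (e : nat),
       [/\ c != 0, injective rs, injective cs &
           f = c *: ('X_[u] * minor K rs cs ^+ (p ^ e))]).
Proof.
move=> chp rm rn; split=> [f f0 van|r2 f szf van].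
  rewrite /nterms -(size_map (@mnm_mx m n)).
  apply: (vanishes_many_terms _ _ _ (vanishes_exp rm rn van)).
  - exact: exp_seq_uniq.
  - exact: exp_coef_neq0.
  - by rewrite -size_eq0 size_map size_eq0 msupp_eq0.
have [||U [subK ext]] := extremal_strip _ (exp_seq_uniq f) (@exp_coef_neq0 _ _ _ f) _
  (vanishes_exp rm rn van).
- exact: ltnW.
- by rewrite size_map.
have [rs [cs [D [c0 [[rs_inj cs_inj D0 c0n] [_ ps cE]]]]]] := extremal_perms r2 ext.
have [_ _ _ van1 _] := ext.
(* [W] is placed on rows [rs] and columns [cs] of an [m] by [n] matrix, without increase of rank. *)
have det0 (W : 'M[K]_r.+1) : (\rank W <= r)%N -> \det (\matrix_(a, b) W a b ^+ D a) = 0.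
  move=> rW.
  pose A : 'M[K]_(m, n) :=
    (\matrix_(i, a) (i == rs a)%:R) *m W *m (\matrix_(b, j) (j == cs b)%:R).
  have AE a b : A (rs a) (cs b) = W a b.
    rewrite mxE (bigD1 b) //= big1 ?addr0 => [|b' b'b]; last first.
      by rewrite !mxE (inj_eq cs_inj) eq_sym (negPf b'b) mulr0.
    rewrite !mxE eqxx mulr1 (bigD1 a) //= big1 ?addr0 => [|a' a'a]; last first.
      by rewrite !mxE (inj_eq rs_inj) eq_sym (negPf a'a) mul0r.
    by rewrite mxE eqxx mul1r.
  have rA : (\rank A <= r)%N.
    by apply: leq_trans rW; apply: leq_trans (mxrankM_maxl _ _) (mxrankM_maxr _ _).
  have /eqP := van1 A rA; rewrite (ev_perms _ ps cE) mulf_eq0 (negPf c0n) /= => /eqP <-.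
  by congr (\det _); apply/matrixP => a b; rewrite [LHS]mxE [RHS]mxE AE.
have [e De] := additive_pow_exponent (D0 ord0) chp (det_pow_additive r2 D0 det0 ord0).
exists c0, (mx_mnm U), rs, cs, e; split=> //.
have Da a : D a = (p ^ e)%N by rewrite -De; exact: (det_pow_exponents_eq D0 det0).
pose X : 'M[{mpoly K[m * n]}]_(m, n) := \matrix_(i, j) xvar K i j.
transitivity (\sum_(N <- map (fun M => subm M U) (exp_seq f))
    exp_coef f (addm N U) *: mon X (addm N U)).
  rewrite [RHS]big_map [RHS]big_map {1}(mpolyE f); apply: eq_big_seq => k kf.
  have ks : mnm_mx k \in exp_seq f by exact: map_f.
  by rewrite subK // -mpolyX_mon /exp_coef mnm_mxK.
(* Frobenius is applied in the polynomial ring, which inherits the characteristic of [K]. *)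
have chM : p = 1%N \/ p \in [pchar {mpoly K[m * n]}].
  case: chp => [[->]|chp]; [by left | right].
  exact: (rmorph_pchar (mpolyC (m * n) (R := K))).
rewrite (perm_big _ ps) big_map big_enum /= /minor (det_pow_pchar _ _ chM).
rewrite mpolyX_mon mulr_sumr scaler_sumr; apply: eq_bigr => pi _.
rewrite cE mon_addm mon_perm_exp [_ * c0]mulrC -scalerA; congr (c0 *: _).
have -> : \prod_a X (rs a) (cs (pi a)) ^+ D a =
    \prod_a (\matrix_(a, b) (\matrix_(i, j) xvar K (rs i) (cs j)) a b ^+ (p ^ e)) a (pi a).
  by apply: eq_bigr => a _; rewrite !mxE Da.
rewrite [in LHS]mulrC mulrCA.
by case: (odd_perm pi); rewrite !(expr1, expr0) ?(scaleN1r, mulN1r) ?(scale1r, mul1r).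
Qed.
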